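(* Algorithm 1 is a factor-$1.5$ approximation algorithm for $1|(p_j,p_j,p_j)|\sum C_j$. That is, Algorithm 1 runs in polynomial time, and for every instance with $a_j=L_j=b_j=p_j$ for all jobs $j$, it outputs a feasible schedule whose sum of completion times is at most $1.5$ times the minimum sum of completion times over all feasible schedules.
   Context: Coupled task scheduling on a single machine: each job $j\in\{1,\dots,n\}$ has a first task of processing time $a_j>0$, a second task of processing time $b_j>0$, and a delay time $L_j\ge 0$. A feasible schedule assigns a starting time $S_j\ge 0$ to each job $j$; the first task occupies $[S_j,S_j+a_j]$, the second task occupies $[S_j+a_j+L_j,\,S_j+a_j+L_j+b_j]$ (the delay is exact, no preemption), and no two of the $2n$ tasks overlap (their intervals have disjoint interiors). Other tasks may be processed during the delay of a job. The completion time of $j$ is $C_j=S_j+a_j+L_j+b_j$, and the objective is to minimize $\sum_{j=1}^n C_j$. Algorithm 1. Step 1: sort the jobs in non-decreasing order of $L_j$ and re-index them in this order. Step 2: for $j=1,\dots,n$ in this order, schedule job $j$ as soon as possible with respect to the partial schedule of jobs $1,\dots,j-1$, i.e. set $S_j:=\min\{t\ge 0:\text{ the machine is idle both in }[t,t+a_j]\text{ and in }[t+a_j+L_j,\,t+a_j+L_j+b_j]\}$ (idle meaning that no already scheduled task overlaps the interior of the interval). *)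

(* Defs.v *)
From HB Require Import structures.
From mathcomp Require Import all_boot all_order all_algebra all_fingroup.

Set Implicit Arguments.
Unset Strict Implicit.
Unset Printing Implicit Defensive.

Import Order.TTheory GRing.Theory Num.Theory.
Local Open Scope ring_scope.

Record instance (R : realFieldType) (n : nat) := Instance {
  first_time : 'I_n -> R;
  delay : 'I_n -> R;
  second_time : 'I_n -> R;
  first_time_gt0 : forall j, 0 < first_time j;
  delay_ge0 : forall j, 0 <= delay j;
  second_time_gt0 : forall j, 0 < second_time j
}.

Section Schedules.
Variables (R : realFieldType) (n : nat) (I : instance R n).
Implicit Types (S : 'I_n -> R) (j : 'I_n) (D : {set 'I_n}) (t : R).

(* A task is a pair (j, k): the first task of job j if k = false, the second
   one if k = true. *)
Definition task_start S (u : 'I_n * bool) : R :=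
  if u.2 then S u.1 + first_time I u.1 + delay I u.1 else S u.1.

Definition task_end S (u : 'I_n * bool) : R :=
  if u.2 then S u.1 + first_time I u.1 + delay I u.1 + second_time I u.1
  else S u.1 + first_time I u.1.

Definition disjoint_interiors (x y x' y' : R) : Prop :=
  forall z, ~ (x < z < y /\ x' < z < y').

Definition feasible S : Prop :=
  (forall j, 0 <= S j) /\
  (forall u v : 'I_n * bool, u != v ->
     disjoint_interiors (task_start S u) (task_end S u)
                        (task_start S v) (task_end S v)).

Definition completion S j : R :=
  S j + first_time I j + delay I j + second_time I j.

Definition total_completion S : R := \sum_(j < n) completion S j.

(* Only the values of S on the set D of already scheduled jobs matter. *)
Definition idle S D (x y : R) : Prop :=
  forall u : 'I_n * bool, u.1 \in D ->
    disjoint_interiors (task_start S u) (task_end S u) x y.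

Definition fits S D j t : Prop :=
  [/\ 0 <= t,
      idle S D t (t + first_time I j)
    & idle S D (t + first_time I j + delay I j)
               (t + first_time I j + delay I j + second_time I j)].

Definition asap S D j : Prop :=
  fits S D j (S j) /\ (forall t, fits S D j t -> S j <= t).

(* The order of jobs with equal delays is not specified by the algorithm, so
   its result is a relation: s k is the job in position k of the sorted list. *)
Definition algorithm1 S : Prop :=
  exists s : {perm 'I_n},
    (forall i k : 'I_n, (i <= k)%N -> delay I (s i) <= delay I (s k)) /\
    (forall k : 'I_n, asap S [set s i | i : 'I_n & (i < k)%N] (s k)).

End Schedules.

(* Model of computation: random access machines with logarithmic cost. The
   registers and the memory cells hold rationals; the memory is only accessed
   through an address held in a register, and execution is stuck when that
   address is not a natural number. There is no multiplication, and every
   elementary instruction or test is charged the bit sizes of the numbers and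
   addresses it reads. *)
Inductive program :=
| Skip
| Const (r c : nat)                (* r := c *)
| Add (r s t : nat)                (* r := s + t *)
| Sub (r s t : nat)                (* r := s - t *)
| Read (r s : nat)                 (* r := memory[s] *)
| Write (r s : nat)               (* memory[r] := s *)
| Seq (P Q : program)
| IfLt (r s : nat) (P Q : program) (* if r < s then P else Q *)
| WhileLt (r s : nat) (P : program).

Record state := State { reg : nat -> rat; mem : nat -> rat }.

Definition upd (f : nat -> rat) (i : nat) (x : rat) : nat -> rat :=
  fun k => if k == i then x else f k.

Definition bits (k : nat) : nat := (trunc_log 2 k).+1.

(* sign, numerator and denominator in binary *)
Definition bitsize (x : rat) : nat :=
  (1 + bits (absz (numq x)) + bits (absz (denq x)))%N.

(* run P m c m' : started in m, P halts in m', at total cost c *)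
Inductive run : program -> state -> nat -> state -> Prop :=
| run_skip m : run Skip m 1 m
| run_const r c m :
    run (Const r c) m (1 + bits c)%N (State (upd (reg m) r c%:R) (mem m))
| run_add r s t m :
    run (Add r s t) m (1 + bitsize (reg m s) + bitsize (reg m t))%N
        (State (upd (reg m) r (reg m s + reg m t)) (mem m))
| run_sub r s t m :
    run (Sub r s t) m (1 + bitsize (reg m s) + bitsize (reg m t))%N
        (State (upd (reg m) r (reg m s - reg m t)) (mem m))
| run_read r s k m :
    reg m s = k%:R ->
    run (Read r s) m (1 + bitsize (reg m s) + bitsize (mem m k))%N
        (State (upd (reg m) r (mem m k)) (mem m))
| run_write r s k m :
    reg m r = k%:R ->
    run (Write r s) m (1 + bitsize (reg m r) + bitsize (reg m s))%N
        (State (reg m) (upd (mem m) k (reg m s)))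
| run_seq P Q m c m' c' m'' :
    run P m c m' -> run Q m' c' m'' -> run (Seq P Q) m (c + c')%N m''
| run_if_true r s P Q m c m' :
    reg m r < reg m s -> run P m c m' ->
    run (IfLt r s P Q) m (1 + bitsize (reg m r) + bitsize (reg m s) + c)%N m'
| run_if_false r s P Q m c m' :
    reg m s <= reg m r -> run Q m c m' ->
    run (IfLt r s P Q) m (1 + bitsize (reg m r) + bitsize (reg m s) + c)%N m'
| run_while_true r s P m c m' c' m'' :
    reg m r < reg m s -> run P m c m' -> run (WhileLt r s P) m' c' m'' ->
    run (WhileLt r s P) m
        (1 + bitsize (reg m r) + bitsize (reg m s) + c + c')%N m''
| run_while_false r s P m :
    reg m s <= reg m r ->
    run (WhileLt r s P) m (1 + bitsize (reg m r) + bitsize (reg m s))%N m.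

Section Encoding.
Variables (n : nat) (I : instance rat n).

Definition input : seq rat :=
  flatten [seq [:: first_time I j; delay I j; second_time I j] | j <- enum 'I_n].

(* n is in register 0, the 3n data are in the memory cells 0, ..., 3n - 1, and
   everything else is 0. *)
Definition initial_state : state :=
  State (upd (fun _ => 0) 0 n%:R) (nth 0 input).

Definition input_size : nat :=
  (bitsize n%:R + \sum_(x <- input) bitsize x)%N.

(* The starting times are read in the n memory cells following the input. *)
Definition output (m : state) : 'I_n -> rat :=
  fun j => mem m (3 * n + j)%N.

End Encoding.

(* The time bound is a polynomial in the bit size of the instance, uniformly
   in n. *)
Definition computes_algorithm1_in_polynomial_time (P : program) : Prop :=
  exists q : {poly nat}, forall (n : nat) (I : instance rat n),
    exists (c : nat) (m : state),
      [/\ run P (initial_state I) c m,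
          (c <= q.[input_size I])%N
        & algorithm1 I (output m)].

(* Main.v *)
(** The algorithm never completes the k-th job of its list later than the sum of
    the lengths 3 p of the first k jobs, because that job could be started after
    all earlier ones. In any feasible schedule the tasks of the jobs completed up
    to time C_j are disjoint and fit into [0, C_j], so C_j is at least the sum of
    2 p over these jobs. For two jobs, whichever completes first is counted in the
    bound of the other, which costs at least the smaller of their two p; the
    sorted list attains this minimum for every pair at once, whence 3/2.

    The running time is polynomial because a starting time is found by scanning
    the scheduled tasks, jumping past each conflict and restarting the scan, with
    at most two jumps per task. All numbers that occur have denominators dividing
    the product of those of the input, and their absolute values are at most linear
    in n plus the sum of the input. *)
Require Import Defs.
From HB Require Import structures.
From mathcomp Require Import all_boot all_order all_algebra all_fingroup.
From mathcomp Require Import zify ring lra.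

Set Implicit Arguments.
Unset Strict Implicit.
Unset Printing Implicit Defensive.

Import Order.TTheory GRing.Theory Num.Theory.
Local Open Scope ring_scope.

(** * Schedules *)

Lemma disjoint_interiorsP (R : realFieldType) (x y x' y' : R) :
  x < y -> x' < y' ->
  disjoint_interiors x y x' y' <-> (y <= x') || (y' <= x).
Proof.
move=> xy xy'; split=> [dis|/orP dis z [/andP[? ?] /andP[? ?]]].
  have [//|x'y /=] := leP y x'; have [//|xy'' /=] := leP y' x.
  (* If the intervals overlapped, the midpoint between the larger left end and the smaller right end
     would lie in both interiors. *)
  pose lo := if x <= x' then x' else x; pose hi := if y <= y' then y else y'.
  case: (dis ((lo + hi) / 2)); rewrite /lo /hi.
  by case: (leP x x') => ?; case: (leP y y') => ?; split; apply/andP; split; lra.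
by case: dis => ?; lra.
Qed.

Lemma disjoint_interiorsC (R : realFieldType) (x y x' y' : R) :
  disjoint_interiors x y x' y' -> disjoint_interiors x' y' x y.
Proof. by move=> dis z [? ?]; apply: (dis z). Qed.

Lemma count_lt (T : eqType) (a1 a2 : pred T) (s : seq T) (x : T) :
  x \in s -> subpred a1 a2 -> a2 x -> ~~ a1 x -> (count a1 s < count a2 s)%N.
Proof.
move=> xs a12 a2x a1x; elim: s xs => //= y s IH.
rewrite inE => /orP[/eqP <-|/IH lt].
  by rewrite a2x (negPf a1x) ltnS sub_count.
by rewrite -addnS leq_add //; case: (boolP (a1 y)) => // /a12 ->.
Qed.

(** Induction on the number of intervals: once the interval with the largest right end is removed,
    all others must end before it starts, so its left end is the new bound [c]. *)
Lemma sum_disjoint_le (R : realFieldType) (T : finType) (x y : T -> R) (c : R)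
    (A : {set T}) :
  (forall u, x u < y u) -> 0 <= c ->
  (forall u v, u \in A -> v \in A -> u != v ->
     disjoint_interiors (x u) (y u) (x v) (y v)) ->
  (forall u, u \in A -> 0 <= x u /\ y u <= c) ->
  \sum_(u in A) (y u - x u) <= c.
Proof.
move=> xy; have [k] := ubnP #|A|; elim: k A c => // k IH A c Ak c0 dis bnd.
have [->|[u0 u0A]] := set_0Vmem A; first by rewrite big_set0.
case: (@Order.TotalTheory.arg_maxP _ R T u0 (mem A) y u0A) => u /= uA umax.
rewrite (big_setD1 u) //=.
have {}uA : u \in A := uA.
have := cardsD1 u A; rewrite uA => cA.
have [u_ge0 u_lec] := bnd u uA.
have le : \sum_(v in A :\ u) (y v - x v) <= x u.
  apply: IH => //; first by lia.
    move=> v w /setD1P[_ vA] /setD1P[_ wA]; exact: dis.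
  move=> v /setD1P[vu vA]; have [v0 _] := bnd v vA; split=> //.
  have /orP[//|] := (disjoint_interiorsP (xy v) (xy u)).1 (dis v u vA uA vu).
  have : y v <= y u by apply: umax.
  by have := xy v; lra.
lra.
Qed.

Section Schedules.
Variables (R : realFieldType) (n : nat) (I : instance R n).
Implicit Types (S : 'I_n -> R) (j : 'I_n) (D : {set 'I_n}) (t : R).

Lemma task_start_lt_end S u : task_start I S u < task_end I S u.
Proof.
by case: u => j []; rewrite /task_start /task_end /= ltrDl
  ?first_time_gt0 ?second_time_gt0.
Qed.

Lemma task_end_le_completion S u : task_end I S u <= completion I S u.1.
Proof.
case: u => j b; rewrite /task_end /completion.
have := second_time_gt0 I j; have := delay_ge0 I j.
by case: b => /=; lra.
Qed.

Lemma eq_fits S S' D j t :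
  {in D, S =1 S'} -> fits I S D j t -> fits I S' D j t.
Proof.
move=> eqS [t0 f1 f2]; split=> // u uD; [have := f1 u uD|have := f2 u uD];
by rewrite /task_start /task_end eqS.
Qed.

Lemma eq_asap S S' D j :
  {in D, S =1 S'} -> S j = S' j -> asap I S D j -> asap I S' D j.
Proof.
move=> eqS eqj [f fmin]; split=> [|t /eq_fits ft]; rewrite -eqj.
  exact: eq_fits f.
by apply/fmin/ft => i iD; rewrite eqS.
Qed.

(* Every blocking task forbids an open interval of starting times, so the least
   admissible time is reached by jumping to the right ends of such intervals. *)
Lemma exists_least_free (F : seq (R * R)) :
  let free t := 0 <= t /\ (forall f, f \in F -> (f.2 <= t) || (t <= f.1)) in
  exists t, free t /\ (forall t', free t' -> t <= t').
Proof.
move=> free.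
(* The potential counts the right ends beyond [t]; each jump lowers it, while [t] stays a lower
   bound of all free times. *)
pose pot t := count (fun f : R * R => t < f.2) F.
suff ex k t : (pot t < k)%N -> 0 <= t -> (forall t', free t' -> t <= t') ->
    exists t, free t /\ (forall t', free t' -> t <= t').
  by apply: (ex (pot 0).+1 0) => // t' [].
elim: k t => // k IH t ptk t0 tmin.
have [/allP ft|/allPn[f fF]] :=
  boolP (all (fun f : R * R => (f.2 <= t) || (t <= f.1)) F).
  by exists t.
rewrite negb_or -!ltNge => /andP[tf2 f1t].
apply: (IH f.2); first 1 last.
- lra.
- by move=> t' ft'; have := tmin t' ft'; case: ft' => _ /(_ _ fF) /orP[]; lra.
apply: (@leq_trans (pot t)) => //; rewrite /pot.
apply: (count_lt fF) => //; first by move=> g; apply: lt_trans.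
by rewrite ltxx.
Qed.

Lemma fitsP S D j t :
  fits I S D j t <-> 0 <= t /\ forall u, u.1 \in D ->
    ((task_end I S u <= t) || (t + first_time I j <= task_start I S u)) &&
    ((task_end I S u <= t + first_time I j + delay I j) ||
     (t + first_time I j + delay I j + second_time I j <= task_start I S u)).
Proof.
have a0 := first_time_gt0 I j; have b0 := second_time_gt0 I j.
have dP u x l : 0 < l ->
    disjoint_interiors (task_start I S u) (task_end I S u) x (x + l) <->
    (task_end I S u <= x) || (x + l <= task_start I S u).
  by move=> l0; apply: disjoint_interiorsP; rewrite ?task_start_lt_end ?ltrDl.
split=> [[t0 f1 f2]|[t0 f]]; split=> // u uD.
- apply/andP; split; first exact/dP/f1.
  exact/dP/f2.
- by apply/dP => //; have /andP[] := f u uD.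
- by apply/dP => //; have /andP[] := f u uD.
Qed.

Lemma exists_asap S D j : exists t, fits I S D j t /\
  (forall t', fits I S D j t' -> t <= t').
Proof.
pose a := first_time I j; pose al := a + delay I j.
(* Intervals of starting times forbidden by a task [u]: first those at which the first task of [j]
   would meet it, then those at which the second one would. *)
pose F := [seq (task_start I S u - a, task_end I S u) |
             u <- enum [pred u : 'I_n * bool | u.1 \in D]] ++
          [seq (task_start I S u - al - second_time I j, task_end I S u - al) |
             u <- enum [pred u : 'I_n * bool | u.1 \in D]].
have fE t : fits I S D j t <->
    0 <= t /\ (forall f, f \in F -> (f.2 <= t) || (t <= f.1)).
  rewrite fitsP; split=> -[t0 ft]; split=> //.
    move=> f; rewrite mem_cat => /orP[] /mapP[u]; rewrite mem_enum inE => uD ->;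
      have /andP[/orP f1 /orP f2] := ft u uD => /=.
      by case: f1 => ?; apply/orP; [left|right]; rewrite /a; lra.
    by case: f2 => ?; apply/orP; [left|right]; rewrite /al /a; lra.
  move=> u uD; have uE : u \in enum [pred u : 'I_n * bool | u.1 \in D].
    by rewrite mem_enum.
  apply/andP; split.
    have /(_ _)/orP := ft (task_start I S u - a, task_end I S u).
    rewrite mem_cat map_f // => /(_ isT) /=.
    by case=> ?; apply/orP; [left|right]; rewrite -/a; lra.
  have /(_ _)/orP :=
    ft (task_start I S u - al - second_time I j, task_end I S u - al).
  rewrite mem_cat orbC map_f // => /(_ isT) /=.
  by rewrite /al /a; case=> ?; apply/orP; [left|right]; lra.
have [t [ft tmin]] := exists_least_free F.
exists t; split=> [|t' /fE]; [exact/fE|exact: tmin].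
Qed.

(** The greedy rule stated for lists, so that a schedule can be extended by one job at the right
    end. *)
Definition greedy S (js : seq 'I_n) : Prop :=
  forall s1 j s2, js = s1 ++ j :: s2 -> asap I S [set i in s1] j.

(** Each choice depends only on the starting times of earlier jobs, so a time assigned to a new job
    disturbs none of the old choices. *)
Lemma greedy_rcons S S' js j :
  j \notin js -> {in js, S =1 S'} -> greedy S js ->
  asap I S' [set i in js] j -> greedy S' (rcons js j).
Proof.
move=> jjs eqS gS aj s1 k s2; case: (lastP s2) => [|s2' k'].
  by rewrite cats1 => /rcons_inj[<- <-].
rewrite -rcons_cons -rcons_cat => /rcons_inj[jsE _].
apply: eq_asap (gS _ _ _ jsE) => [i|]; last first.
  by apply: eqS; rewrite jsE mem_cat mem_head orbT.
by rewrite inE => is1; apply: eqS; rewrite jsE mem_cat is1.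
Qed.

Lemma exists_greedy (js : seq 'I_n) : uniq js -> exists S, greedy S js.
Proof.
elim/last_ind: js => [|js j IH].
  by exists (fun=> 0) => -[].
rewrite rcons_uniq => /andP[jjs /IH[S gS]].
have [t [ft tmin]] := exists_asap S [set i in js] j.
pose S' i := if i == j then t else S i.
have eqS : {in js, S =1 S'}.
  by move=> i ijs; rewrite /S'; case: eqP => // ij; rewrite ij (negPf jjs) in ijs.
have eqS' : {in [set i in js], S =1 S'} by move=> i; rewrite inE; exact: eqS.
exists S'; apply: greedy_rcons eqS gS _ => //.
have S'j : S' j = t by rewrite /S' eqxx.
split; rewrite S'j; first exact: eq_fits ft.
by move=> t' ft'; apply/tmin/(eq_fits _ ft') => i /eqS'.
Qed.

(** A duplicate-free list of [n] jobs, read as an injective tuple, is the required permutation; the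
    jobs in positions below [k] are those of [take k js]. *)
Lemma algorithm1_seq S (js : seq 'I_n) :
  uniq js -> size js = n -> sorted (relpre (delay I) <=%R) js ->
  greedy S js -> algorithm1 I S.
Proof.
move=> ujs sjs srt gS.
pose js_tuple := Tuple (introT eqP sjs).
have tnth_inj : injective (tnth js_tuple) by apply/tuple_uniqP.
have leT : transitive (relpre (delay I) <=%R) by move=> x y z; apply: le_trans.
exists (perm tnth_inj); split=> [i k ik|k]; rewrite !permE.
  rewrite !(tnth_nth i) /=.
  by apply: (sorted_leq_nth leT _ _ srt);
    rewrite ?inE ?sjs // => x /=; apply: lexx.
have -> : [set perm tnth_inj i | i : 'I_n & (i < k)%N] = [set i in take k js].
  apply/setP => i; rewrite inE; apply/imsetP/idP => [[l lk ->]|/(nthP i)[l]].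
    rewrite permE (tnth_nth i) /= -(@nth_take k) //; last by rewrite inE in lk.
    by apply: mem_nth; rewrite size_takel ?sjs ?(ltnW (ltn_ord k)) //; rewrite inE in lk.
  rewrite size_takel ?sjs ?(ltnW (ltn_ord k)) // => lk <-.
  exists (Ordinal (ltn_trans lk (ltn_ord k))); first by rewrite inE.
  by rewrite permE (tnth_nth i) /= nth_take.
apply: (gS _ _ (drop k.+1 js)).
by rewrite (tnth_nth k) /= -drop_nth ?sjs // cat_take_drop.
Qed.

(** Programs handle rationals only, so over a general ordered field the existence of an output is
    derived directly from a sorted list. *)
Lemma exists_algorithm1 : exists S, algorithm1 I S.
Proof.
pose js := sort (relpre (delay I) <=%R) (enum 'I_n).
have ujs : uniq js by rewrite sort_uniq enum_uniq.
have [S gS] := exists_greedy ujs.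
exists S; apply: algorithm1_seq gS => //; first by rewrite size_sort size_enum_ord.
by apply: sort_sorted => x y; apply: le_total.
Qed.

(** Of two different jobs, the one scheduled later fits around the earlier one; the two tasks of one
    job are kept in order by its nonnegative delay. *)
Lemma algorithm1_feasible S : algorithm1 I S -> feasible I S.
Proof.
move=> [s [_ sP]]; split=> [j|].
  by have [[]] := sP ((s^-1)%g j); rewrite permKV.
have dis (i k : 'I_n) b b' : (i < k)%N ->
    disjoint_interiors (task_start I S (s i, b)) (task_end I S (s i, b))
                       (task_start I S (s k, b')) (task_end I S (s k, b')).
  move=> ik; have [[_ f1 f2] _] := sP k.
  have iD : (s i, b).1 \in [set s i | i : 'I_n & (i < k)%N].
    by apply/imsetP; exists i; rewrite ?inE.
  by case: b'; [apply: f2|apply: f1].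
move=> [j b] [j' b'].
rewrite -(permKV s j) -(permKV s j').
move: (s^-1 j)%g (s^-1 j')%g => i k.
case: (ltngtP i k) => [ik _|ki _|/val_inj-> /=].
- exact: dis.
- exact/disjoint_interiorsC/dis.
rewrite xpair_eqE eqxx /= => bb'.
apply/disjoint_interiorsP; rewrite ?task_start_lt_end //.
have := delay_ge0 I (s k); have := first_time_gt0 I (s k).
by case: b b' bb' => -[] //= _; rewrite /task_end /task_start /= => ? ?;
  apply/orP; [right|left]; lra.
Qed.

End Schedules.

(** * The approximation ratio for equal processing and delay times *)

Section Ratio.
Variables (R : realFieldType) (n : nat) (I : instance R n) (p : 'I_n -> R).
Hypothesis Ip : forall j,
  [/\ first_time I j = p j, delay I j = p j & second_time I j = p j].

(** The tasks of the jobs counted on the left are disjoint intervals inside [[0, C_j]], and each job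
    has two of them, of length [p i]. *)
Lemma completion_ge S j :
  feasible I S -> 
  \sum_(i | completion I S i <= completion I S j) 2 * p i <= completion I S j.
Proof.
move=> [S0 dis].
pose A := [set u : 'I_n * bool | completion I S u.1 <= completion I S j].
have p0 i : 0 < p i by have [<- _ _] := Ip i; apply: first_time_gt0.
have := @sum_disjoint_le R _ (task_start I S) (task_end I S) (completion I S j) A.
have -> : \sum_(u in A) (task_end I S u - task_start I S u) =
    \sum_(i | completion I S i <= completion I S j) 2 * p i.
  transitivity (\sum_(i | completion I S i <= completion I S j)
    \sum_(b : bool) (task_end I S (i, b) - task_start I S (i, b))).
    by rewrite pair_big_dep /=; apply: eq_big => [[i b]|[i b] _] //;
      rewrite inE /= andbT.
  apply: eq_bigr => i _; rewrite big_bool /task_end /task_start /=.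
  by have [-> -> ->] := Ip i; lra.
apply.
- exact: task_start_lt_end.
- rewrite /completion; have := S0 j; have := p0 j.
  by have [-> -> ->] := Ip j; lra.
- by move=> u v _ _; apply: dis.
- move=> u; rewrite inE => uj; split.
    rewrite /task_start; have := S0 u.1; have := p0 u.1.
    by have [-> -> _] := Ip u.1; case: u.2; lra.
  exact: le_trans (task_end_le_completion _ _ _) uj.
Qed.

Let p_gt0 i : 0 < p i. Proof. by have [<- _ _] := Ip i; apply: first_time_gt0. Qed.

(** The least possible contribution of a pair of jobs to the symmetrised sum of [p]; on the diagonal
    it is [2 * p i], as a job counts itself twice there. *)
Let weight (i j : 'I_n) := Num.min (p i) (p j) + (if i == j then p i else 0).

(* Of two jobs, one completes first and is counted in the sum of the other. *)
Lemma sum_by_key_ge (key : 'I_n -> R) :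
  \sum_i \sum_j weight i j <= 2 * \sum_j \sum_(i | key i <= key j) p i.
Proof.
pose c i j := if key i <= key j then p i else 0.
have -> : \sum_j \sum_(i | key i <= key j) p i = \sum_i \sum_j c i j.
  by rewrite exchange_big; apply: eq_bigr => j _; rewrite big_mkcond.
(* Doubling the sum and transposing one copy gives the terms [c i j + c j i], which are compared
   with the weights one by one. *)
rewrite mulr_natl mulr2n [X in _ <= _ + X]exchange_big -big_split /=.
apply: ler_sum => i _; rewrite -big_split; apply: ler_sum => j _ /=.
rewrite /weight /c; have := p_gt0 i; have := p_gt0 j.
case: eqP => [->|_]; first by rewrite lexx minxx; lra.
by rewrite minElt; case: (ltP (p i)); case: (leP (key i)); case: (leP (key j)); lra.
Qed.

(** Strong induction on the position: by then all earlier jobs have ended by 3 times the sum of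
    their [p], so this time is an admissible start and bounds the greedy one. *)
Lemma algorithm1_completion_le S (s : {perm 'I_n}) (k : 'I_n) :
  (forall k : 'I_n, asap I S [set s i | i : 'I_n & (i < k)%N] (s k)) ->
  completion I S (s k) <= 3 * \sum_(i < n | (i <= k)%N) p (s i).
Proof.
move=> sP; have [m] := ubnP k; elim: m k => // m IH k km.
have sum_ge0 (P : pred 'I_n) : 0 <= \sum_(i < n | P i) p (s i).
  by apply: sumr_ge0 => i _; apply: ltW.
have -> : \sum_(i < n | (i <= k)%N) p (s i) =
    p (s k) + \sum_(i < n | (i < k)%N) p (s i).
  rewrite (bigD1 k) //=; congr (_ + _); apply: eq_bigl => i.
  by rewrite ltn_neqAle andbC.
have [_ /(_ (3 * \sum_(i < n | (i < k)%N) p (s i)))] := sP k.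
rewrite /completion; have [-> -> ->] := Ip (s k).
suff f : fits I S [set s i | i : 'I_n & (i < k)%N] (s k)
    (3 * \sum_(i < n | (i < k)%N) p (s i)) by move=> /(_ f); lra.
apply/fitsP; split=> [|u /imsetP[i]]; first by have := sum_ge0 (fun i => (i < k)%N); lra.
rewrite inE => ik usi; have ikm : (i < m)%N by lia.
have ut := le_trans (task_end_le_completion I S u) _.
have {}ut : task_end I S u <= 3 * \sum_(i < n | (i < k)%N) p (s i).
  apply: ut; rewrite usi; apply: le_trans (IH i ikm) _.
  rewrite ler_pM2l // [leLHS]big_mkcond [leRHS]big_mkcond.
  apply: ler_sum => l _; have := p_gt0 (s l).
  by case: (leqP l i) => [li|_]; [rewrite (leq_ltn_trans li ik)|case: ifP]; lra.
have [-> -> _] := Ip (s k); have := p_gt0 (s k).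
by move=> pk; apply/andP; split; apply/orP; left; lra.
Qed.

Lemma algorithm1_total_le S S' :
  algorithm1 I S -> feasible I S' ->
  total_completion I S <= 3 / 2 * total_completion I S'.
Proof.
move=> [s [srt sP]] fS'.
have p_mono (i k : 'I_n) : (i <= k)%N -> p (s i) <= p (s k).
  by move=> /srt; have [_ -> _] := Ip (s i); have [_ -> _] := Ip (s k).
have opt : \sum_i \sum_j weight i j <= total_completion I S'.
  apply: le_trans (sum_by_key_ge (completion I S')) _.
  rewrite mulr_sumr; apply: ler_sum => j _.
  by rewrite mulr_sumr; apply: completion_ge.
(* The sum of all weights links the two schedules: it is at most the optimum and at least two thirds
   of the greedy total. *)
suff : 2 * total_completion I S <= 3 * \sum_i \sum_j weight i j by lra.
rewrite /total_completion (reindex_inj (@perm_inj _ s)) /=.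
apply: (@le_trans _ _
  (2 * \sum_(k < n) 3 * \sum_(i < n | (i <= k)%N) p (s i))).
  by rewrite ler_pM2l //; apply: ler_sum => k _; apply: algorithm1_completion_le.
rewrite -mulr_sumr mulrCA ler_pM2l //.
rewrite [leRHS](reindex_inj (@perm_inj _ s)) /=.
pose c (i k : 'I_n) := if (i <= k)%N then p (s i) else 0.
have -> : \sum_(k < n) \sum_(i < n | (i <= k)%N) p (s i) = \sum_i \sum_k c i k.
  by rewrite exchange_big; apply: eq_bigr => j _; rewrite big_mkcond.
rewrite mulr_natl mulr2n [X in _ + X <= _]exchange_big -big_split /=.
apply: ler_sum => i _; rewrite -big_split /= [leRHS](reindex_inj (@perm_inj _ s)).
apply: ler_sum => k _ /=.
(* In the sorted list the job in the earlier position has the smaller [p], so the two terms of a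
   pair do not exceed its weight. *)
rewrite /weight /c (inj_eq perm_inj) -val_eqE /= minElt.
case: (ltngtP i k) => [ik|ki|/val_inj ->]; last by rewrite ltxx; lra.
- by have := p_mono _ _ (ltnW ik); case: ltP; lra.
- by have := p_mono _ _ (ltnW ki); case: ltP; lra.
Qed.

End Ratio.

(** * Programs *)

(* Both [Sub] and [mem] are hidden by MathComp names. *)
Import Defs.

(** * Cost triples and weakest preconditions *)

Section Triples.
Variable B : nat.

(* The cost is counted in units of 2B + 1, which bounds the cost of one
   instruction on numbers of at most B bits. *)
Definition ok (u : nat) (P : program) (m : state) (Q : state -> Prop) : Prop :=
  exists c m', [/\ run P m c m', (c <= u * (2 * B).+1)%N & Q m'].

Lemma ok_weaken u v P m (Q Q' : state -> Prop) :
  ok u P m Q -> (u <= v)%N -> (forall m', Q m' -> Q' m') -> ok v P m Q'.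
Proof.
move=> [c [m' [r cu q]]] uv QQ'; exists c, m'; split=> //; last exact: QQ'.
by apply: leq_trans cu _; rewrite leq_mul2r uv orbT.
Qed.

Lemma ok_seq u v P P' m Q :
  ok u P m (fun m' => ok v P' m' Q) -> ok (u + v) (Seq P P') m Q.
Proof.
move=> [c [m' [r cu [c' [m'' [r' cv q]]]]]].
exists (c + c')%N, m''; split=> //; first exact: run_seq r r'.
by rewrite mulnDl leq_add.
Qed.

(** The index [k] is a variant, so at most [k] rounds are run; the additional unit in [u.+1] pays
    for the test, and [k.+1] covers the last, failing one. *)
Lemma ok_while u r s P (Inv : nat -> state -> Prop) :
  (forall k m, Inv k m ->
     [/\ (bitsize (reg m r) <= B)%N, (bitsize (reg m s) <= B)%N
       & reg m r < reg m s ->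
         ok u P m (fun m' => exists2 k', (k' < k)%N & Inv k' m')]) ->
  forall k m, Inv k m ->
  ok (k.+1 * u.+1) (WhileLt r s P) m
     (fun m' => (exists k', Inv k' m') /\ reg m' s <= reg m' r).
Proof.
move=> step k; have [K] := ubnP k; elim: K k => // K IH k kK m inv.
have [br bs body] := step k m inv.
case: (ltP (reg m r) (reg m s)) => rs; last first.
  exists (1 + bitsize (reg m r) + bitsize (reg m s))%N, m.
  by split; [exact: run_while_false|nia|split=> //; exists k].
have [c [m' [r1 c1 [k' kk' inv']]]] := body rs.
have [|c' [m'' [r2 c2 q]]] := IH k' _ m' inv'; first by lia.
exists (1 + bitsize (reg m r) + bitsize (reg m s) + c + c')%N, m''.
split=> //; first exact: run_while_true r1 r2.
have : (k'.+1 * u.+1 <= k * u.+1)%N by rewrite leq_mul2r kk' orbT.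
by nia.
Qed.

(** Weakest preconditions of loop-free code, including the bit bounds behind its cost. Loops get
    [False] and are left to [ok_while]. *)
Fixpoint wp (P : program) (m : state) (Q : state -> Prop) : Prop :=
  match P with
  | Skip => Q m
  | Const r c =>
      (bits c <= B)%N /\ Q (State (upd (reg m) r c%:R) (mem m))
  | Add r s t =>
      [/\ (bitsize (reg m s) <= B)%N, (bitsize (reg m t) <= B)%N
        & Q (State (upd (reg m) r (reg m s + reg m t)) (mem m))]
  | Sub r s t =>
      [/\ (bitsize (reg m s) <= B)%N, (bitsize (reg m t) <= B)%N
        & Q (State (upd (reg m) r (reg m s - reg m t)) (mem m))]
  | Read r s =>
      exists k, [/\ reg m s = k%:R, (bitsize (reg m s) <= B)%N,
                    (bitsize (mem m k) <= B)%N
                  & Q (State (upd (reg m) r (mem m k)) (mem m))]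
  | Write r s =>
      exists k, [/\ reg m r = k%:R, (bitsize (reg m r) <= B)%N,
                    (bitsize (reg m s) <= B)%N
                  & Q (State (reg m) (upd (mem m) k (reg m s)))]
  | Seq P P' => wp P m (fun m' => wp P' m' Q)
  | IfLt r s P P' =>
      [/\ (bitsize (reg m r) <= B)%N, (bitsize (reg m s) <= B)%N,
          reg m r < reg m s -> wp P m Q & reg m s <= reg m r -> wp P' m Q]
  | WhileLt _ _ _ => False
  end.

(** Both branches of a test are added up, which is coarse but independent of the state. The value
    for a loop is a default that [wp] makes irrelevant. *)
Fixpoint steps (P : program) : nat :=
  match P with
  | Seq P Q => steps P + steps Q
  | IfLt _ _ P Q => (steps P + steps Q).+1
  | _ => 1
  end.

Lemma wp_ok P m Q : wp P m Q -> ok (steps P) P m Q.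
Proof.
elim: P m Q => [|r c|r s t|r s t|r s|r s|P IHP P' IHP'|r s P IHP P' IHP'|] m Q /=.
- by exists 1%N, m; split=> //; constructor.
- by move=> [bc q]; exists (1 + bits c)%N; eexists; split; [constructor|lia|].
- move=> [bs bt q]; exists (1 + bitsize (reg m s) + bitsize (reg m t))%N; eexists.
  by split; [constructor|lia|].
- move=> [bs bt q]; exists (1 + bitsize (reg m s) + bitsize (reg m t))%N; eexists.
  by split; [constructor|lia|].
- move=> [k [e bs bt q]]; exists (1 + bitsize (reg m s) + bitsize (mem m k))%N; eexists.
  by split; [exact: run_read e|lia|].
- move=> [k [e bs bt q]]; exists (1 + bitsize (reg m r) + bitsize (reg m s))%N; eexists.
  by split; [exact: run_write e|lia|].
- move=> /IHP okP; apply: ok_seq; apply: ok_weaken okP _ _ => // m'; exact: IHP'.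
- move=> [br bs wt wf]; case: (ltP (reg m r) (reg m s)) => rs.
    have [c [m' [r1 c1 q]]] := IHP _ _ (wt rs).
    exists (1 + bitsize (reg m r) + bitsize (reg m s) + c)%N, m'.
    by split=> //; [exact: run_if_true|nia].
  have [c [m' [r1 c1 q]]] := IHP' _ _ (wf rs).
  exists (1 + bitsize (reg m r) + bitsize (reg m s) + c)%N, m'.
  by split=> //; [exact: run_if_false|nia].
- by [].
Qed.

Lemma wp_skip m Q : wp Skip m Q = Q m. Proof. by []. Qed.

Lemma wp_const r c m Q : wp (Const r c) m Q =
  ((bits c <= B)%N /\ Q (State (upd (reg m) r c%:R) (mem m))).
Proof. by []. Qed.

Lemma wp_add r s t m Q : wp (Add r s t) m Q =
  [/\ (bitsize (reg m s) <= B)%N, (bitsize (reg m t) <= B)%N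
    & Q (State (upd (reg m) r (reg m s + reg m t)) (mem m))].
Proof. by []. Qed.

Lemma wp_sub r s t m Q : wp (Sub r s t) m Q =
  [/\ (bitsize (reg m s) <= B)%N, (bitsize (reg m t) <= B)%N
    & Q (State (upd (reg m) r (reg m s - reg m t)) (mem m))].
Proof. by []. Qed.

Lemma wp_read r s m Q : wp (Read r s) m Q =
  exists k, [/\ reg m s = k%:R, (bitsize (reg m s) <= B)%N,
    (bitsize (mem m k) <= B)%N & Q (State (upd (reg m) r (mem m k)) (mem m))].
Proof. by []. Qed.

Lemma wp_write r s m Q : wp (Write r s) m Q =
  exists k, [/\ reg m r = k%:R, (bitsize (reg m r) <= B)%N,
    (bitsize (reg m s) <= B)%N & Q (State (reg m) (upd (mem m) k (reg m s)))].
Proof. by []. Qed.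

Lemma wp_seq P P' m Q : wp (Seq P P') m Q = wp P m (fun m' => wp P' m' Q).
Proof. by []. Qed.

Lemma wp_if r s P P' m Q : wp (IfLt r s P P') m Q =
  [/\ (bitsize (reg m r) <= B)%N, (bitsize (reg m s) <= B)%N,
      reg m r < reg m s -> wp P m Q & reg m s <= reg m r -> wp P' m Q].
Proof. by []. Qed.

(** Unfolds one instruction at a time; plain simplification would expand a whole program at once. *)
Definition wpE :=
  (wp_skip, wp_const, wp_add, wp_sub, wp_read, wp_write, wp_seq, wp_if).

End Triples.

Arguments wp : simpl never.

(** * Registers and memory left unchanged by a program *)

Fixpoint written (P : program) : seq nat :=
  match P with
  | Const r _ | Add r _ _ | Sub r _ _ | Read r _ => [:: r]
  | Seq P Q | IfLt _ _ P Q => written P ++ written Q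
  | WhileLt _ _ P => written P
  | _ => [::]
  end.

Fixpoint read_only (P : program) : bool :=
  match P with
  | Write _ _ => false
  | Seq P Q | IfLt _ _ P Q => read_only P && read_only Q
  | WhileLt _ _ P => read_only P
  | _ => true
  end.

(** With the syntactic list [written P] for [W], the condition [r \notin W] is settled by
    computation, and specifications need not mention unchanged registers. *)
Definition frame (W : seq nat) (m m' : state) : Prop :=
  forall r, r \notin W -> reg m' r = reg m r.

Lemma run_frame P m c m' : run P m c m' -> frame (written P) m m'.
Proof.
have upd_frame r x f g : frame [:: r] (State f g) (State (upd f r x) g).
  by move=> k; rewrite inE /= /upd => /negPf ->.
elim=> {P m c m'} //=.
- by move=> r c [f g]; exact: upd_frame.
- by move=> r s t [f g]; exact: upd_frame.
- by move=> r s t [f g]; exact: upd_frame.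
- by move=> r s k [f g] _; exact: upd_frame.
- move=> P Q m c m' c' m'' _ IH _ IH' r; rewrite mem_cat negb_or => /andP[rP rQ].
  by rewrite IH' // IH.
- by move=> r s P Q m c m' _ _ IH k; rewrite mem_cat negb_or => /andP[kP _]; exact: IH.
- by move=> r s P Q m c m' _ _ IH k; rewrite mem_cat negb_or => /andP[_ kQ]; exact: IH.
- by move=> r s P m c m' c' m'' _ _ IH _ IH' k kP; rewrite IH' // IH.
Qed.

Lemma run_read_only P m c m' : run P m c m' -> read_only P -> mem m' = mem m.
Proof.
elim=> {P m c m'} //=.
- by move=> P Q m c m' c' m'' _ IH _ IH' /andP[/IH <- /IH' <-].
- by move=> r s P Q m c m' _ _ IH /andP[/IH].
- by move=> r s P Q m c m' _ _ IH /andP[_ /IH].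
- by move=> r s P m c m' c' m'' _ _ IH _ IH' k; rewrite IH' // IH.
Qed.

Lemma ok_frame B u P m Q :
  ok B u P m Q -> ok B u P m (fun m' => Q m' /\ frame (written P) m m').
Proof.
by move=> [c [m' [r cu q]]]; exists c, m'; split=> //; split=> //; apply: run_frame r.
Qed.

Lemma ok_read_only B u P m Q : read_only P ->
  ok B u P m Q -> ok B u P m (fun m' => Q m' /\ mem m' = mem m).
Proof.
move=> ro [c [m' [r cu q]]]; exists c, m'; split=> //; split=> //.
exact: run_read_only r ro.
Qed.

(** * Bounds on the numbers that occur *)

Section Size.
Variables D X : nat.
Hypothesis D_gt0 : (0 < D)%N.

(* The numbers handled by the program have denominators dividing D, and their
   absolute values are bounded by small multiples of X. *)
Definition sized (c : nat) (x : rat) : Prop :=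
  x * D%:R \is a Num.int /\ `|x| <= c%:R * X%:R.

Lemma sized_add c d x y : sized c x -> sized d y -> sized (c + d) (x + y).
Proof.
move=> [ix lx] [iy ly]; split; first by rewrite mulrDl rpredD.
by apply: le_trans (ler_normD _ _) _; rewrite natrD mulrDl lerD.
Qed.

Lemma sized_sub c d x y : sized c x -> sized d y -> sized (c + d) (x - y).
Proof.
move=> sx [iy ly]; apply: sized_add => //.
by split; rewrite ?mulNr ?rpredN ?normrN.
Qed.

Lemma sized_nat k : (k <= X)%N -> sized 1 k%:R.
Proof.
by move=> kX; split; rewrite ?rpredM ?rpred_nat // mul1r normr_nat ler_nat.
Qed.

(** Counting summands would let the constant grow with every jump; an a priori bound [u] on the
    starting times resets it to 1. *)
Lemma sized_nonneg x u : x * D%:R \is a Num.int -> 0 <= x <= u -> sized 1 u ->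
  sized 1 x.
Proof.
move=> ix /andP[x0 xu] [_ lu]; split=> //; rewrite ger0_norm //.
by apply: le_trans lu; rewrite ger0_norm //; lra.
Qed.

(** The factor 64 leaves room for sums of several sized numbers; the remaining terms are for the
    sign and the denominator. *)
Definition word : nat := (1 + bits (64 * X * D) + bits D)%N.

Lemma leq_bits i j : (i <= j)%N -> (bits i <= bits j)%N.
Proof. by move=> ij; rewrite ltnS leq_trunc_log. Qed.

(** By coprimality, [numq x * D = z * denq x] forces the reduced denominator to divide [D]; the
    numerator is, in absolute value, [|x|] times this denominator. *)
Lemma sized_word c x : sized c x -> (c <= 64)%N -> (bitsize x <= word)%N.
Proof.
move=> [/intrP[z xz] lx] c64.
have xE : x = (numq x)%:~R / (denq x)%:~R by rewrite divq_num_den.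
have d0 : (denq x)%:~R != 0 :> rat by rewrite intr_eq0 denq_neq0.
have zE : numq x * D%:Z = z * denq x.
  apply: (@intr_inj rat); rewrite !intrM -xz {2}xE -[D%:Z%:~R]/(D%:R).
  by field.
have dD : (absz (denq x) %| D)%N.
  rewrite -(@Gauss_dvdr _ (absz (numq x))); last by rewrite coprime_sym coprime_num_den.
  by rewrite -[D]/(absz D%:Z) -abszM zE abszM dvdn_mull.
have dleD := dvdn_leq D_gt0 dD.
rewrite /bitsize /word !leq_add ?leq_bits //.
have : ((absz (numq x))%:R : rat) <= (64 * X * D)%:R.
  have -> : ((absz (numq x))%:R : rat) = `|x| * (absz (denq x))%:R.
    by rewrite !natr_absz !intr_norm numqE normrM.
  apply: (@le_trans _ _ (c%:R * X%:R * D%:R)).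
    by apply: ler_pM; [exact: normr_ge0|exact: ler0n|exact: lx|rewrite ler_nat].
  by rewrite -!natrM ler_nat !leq_mul2r c64 !orbT.
by rewrite ler_nat.
Qed.

End Size.

(** * Searching for the earliest starting time *)

Local Notation "P ;; Q" := (Seq P Q) (at level 61, right associativity).

(** Memory layout: the input below [3n], the output up to [4n], then up to [8n] a table of the
    scheduled tasks, as pairs of start and end. [rBase], [rEnd] and [rLimit] delimit this table,
    [rI] scans it, [rS] and [rE] hold the entry read. The current job is in [rA], [rAL] (the offset
    of its second task) and [rB], its tentative start in [rT]. *)
Local Notation rN := 0%N.
Local Notation rZero := 1%N.
Local Notation rOne := 2%N.
Local Notation r3N := 3%N.
Local Notation rBase := 4%N.
Local Notation rEnd := 5%N.
Local Notation rLimit := 6%N.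
Local Notation rKey := 7%N.
Local Notation rJ := 8%N.
Local Notation rK := 9%N.
Local Notation rP := 10%N.
Local Notation rX := 11%N.
Local Notation rA := 12%N.
Local Notation rAL := 13%N.
Local Notation rB := 14%N.
Local Notation rY := 15%N.
Local Notation rT := 16%N.
Local Notation rI := 17%N.
Local Notation rS := 18%N.
Local Notation rE := 19%N.
Local Notation rNext := 20%N.

Lemma updE f i x k : upd f i x k = if k == i then x else f k.
Proof. by []. Qed.

Ltac sized_tac :=
  match goal with
  | H : sized _ _ _ ?x |- sized _ _ _ ?x => exact H
  | |- sized _ _ _ (_ - _) => apply: sized_sub; sized_tac
  | |- sized _ _ _ (_ + _) => apply: sized_add; sized_tac
  end.

Ltac bounded :=
  rewrite /= ?updE /=;
  match goal with
  | D_gt0 : is_true (0 < ?D)%N |- is_true (leq (bitsize _) (word ?D _)) =>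
      eapply (sized_word D_gt0); [solve [sized_tac] | by []]
  end.

(** Symbolic execution of one instruction: [access] is given the address of a memory access as a
    natural number, [symex] treats arithmetic and tests. *)
Ltac access k H :=
  rewrite ?wpE; exists k;
  split; [exact H | bounded | bounded | rewrite /= ?updE /=].

Ltac symex :=
  rewrite ?wpE;
  match goal with
  | |- and3 (is_true (leq (bitsize _) _)) (is_true (leq (bitsize _) _)) _ =>
      split; [bounded | bounded | ]
  | |- and4 (is_true (leq (bitsize _) _)) (is_true (leq (bitsize _) _)) _ _ =>
      split; [bounded | bounded | | ]
  end; rewrite /= ?updE /=.

Section Clear.
Implicit Types (f : rat * rat) (t : rat).

(** A task placed at [t + off] with length [len] avoids the interval [f]. The offset is 0 for the
    first task of a job and [a + L] for the second. *)
Definition clear (off len : rat) f t := (f.2 <= t + off) || (t + off + len <= f.1).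

Definition jump (off len : rat) f t := if clear off len f t then t else f.2 - off.

Lemma jumpP off len f t :
  (clear off len f t /\ jump off len f t = t) \/
  [/\ ~~ clear off len f t, t + off < f.2 & jump off len f t = f.2 - off].
Proof.
rewrite /jump; case cl: (clear off len f t); [by left|right].
by move/negbT: cl => cl; split=> //; move: cl; rewrite negb_or -!ltNge => /andP[].
Qed.

(** In a conflict at [t], no later time can place the task before [f], so a clear one must place it
    after the end of [f]. *)
Lemma jump_least off len f t t' :
  t <= t' -> clear off len f t' -> jump off len f t <= t'.
Proof.
by rewrite /jump /clear => tt' /orP; case: ifP => // /norP[]; rewrite -!ltNge; lra.
Qed.

Lemma le_jump off len f t : t <= jump off len f t.
Proof. by case: (jumpP off len f t) => [[_ ->]|[_ + ->]]; lra. Qed.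

(* Each conflict raises the starting time past one of the 2 |F| values f.2 and
   f.2 - al, so this counts the remaining conflicts. *)
Definition pot (al : rat) (F : seq (rat * rat)) (t : rat) : nat :=
  (count (fun f => (t < f.2)%R) F + count (fun f => (t + al < f.2)%R) F)%N.

Lemma pot_le_size al F t : (pot al F t <= 2 * size F)%N.
Proof. by rewrite mul2n -addnn leq_add ?count_size. Qed.

Lemma ltn_pot al F f t t' : f \in F -> t <= t' ->
  (t < f.2 <= t') || (t + al < f.2 <= t' + al) -> (pot al F t' < pot al F t)%N.
Proof.
move=> fF tt' /orP[]/andP[lo hi]; rewrite /pot.
  rewrite -addSn leq_add //; last by apply: sub_count => g /=; lra.
  by apply: (count_lt fF) => [g /=||]; rewrite -?leNgt //; lra.
rewrite -addnS leq_add //; first by apply: sub_count => g /=; lra.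
by apply: (count_lt fF) => [g /=||]; rewrite -?leNgt //; lra.
Qed.

(** A conflict of the first task moves [t] past [f.2], one of the second moves [t + al] past [f.2];
    either way one of the two counts drops. *)
Lemma jump_pot a al b F f t : f \in F ->
  let t1 := jump 0 a f t in let t2 := jump al b f t1 in
  if clear 0 a f t && clear al b f t1 then t2 = t
  else (pot al F t2 < pot al F t)%N.
Proof.
move=> fF t1 t2; rewrite {}/t2 {}/t1.
case: (jumpP 0 a f t) => [[-> ->]|[/negPf-> lo ->]] /=.
  case: (jumpP al b f t) => [[-> ->]|[/negPf-> lo ->]] //=.
  by apply: (ltn_pot fF); [lra|apply/orP; right; lra].
apply: (ltn_pot fF); have := le_jump al b f (f.2 - 0); first by lra.
by move=> ?; apply/orP; left; lra.
Qed.

End Clear.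

(** A conflict resets [rNext] to the start of the table, since the new time may clash with entries
    already passed. *)
Definition push (off len : nat) : program :=
  Add rX rT off ;; Add rY rX len ;;
  IfLt rS rY (IfLt rX rE (Sub rT rE off ;; Add rNext rBase rZero) Skip) Skip.

Definition fetch : program :=
  Read rS rI ;; Add rX rI rOne ;; Read rE rX ;; Add rNext rX rOne.

Definition scan_body : program :=
  fetch ;; push rZero rA ;; push rAL rB ;; Add rI rNext rZero.

Definition earliest : program :=
  Sub rT rZero rZero ;; Add rI rBase rZero ;; WhileLt rI rEnd scan_body.

(** Lexicographic order in one number: fewer remaining conflicts outweigh a restart of the scan at
    entry 0. *)
Lemma ltn_lex u v s i : (u < v)%N -> (u * s.+1 + (s - 0) < v * s.+1 + (s - i))%N.
Proof. by nia. Qed.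

(** * Correctness and cost of the scan *)

Section Scan.
Variables D X : nat.
Hypothesis D_gt0 : (0 < D)%N.
Local Notation sized := (sized D X).
Local Notation ok := (ok (word D X)).
Local Notation wp := (wp (word D X)).

Lemma push_ok m off len :
  (off, len) \in [:: (rZero, rA); (rAL, rB)] ->
  (forall r, r \in [:: rZero; rBase; rA; rAL; rB; rT; rS; rE] -> sized 1 (reg m r)) ->
  let f := (reg m rS, reg m rE) in
  let o := reg m off in let l := reg m len in
  ok (steps (push off len)) (push off len) m (fun m' =>
    reg m' rT = jump o l f (reg m rT) /\
    reg m' rNext = if clear o l f (reg m rT) then reg m rNext
                   else reg m rBase + reg m rZero).
Proof.
move=> offlen sz f o l; apply: wp_ok.
have [s0 sb sa sal] : [/\ sized 1 (reg m rZero), sized 1 (reg m rBase),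
  sized 1 (reg m rA) & sized 1 (reg m rAL)] by split; apply: sz.
have [sB sT sS sE] : [/\ sized 1 (reg m rB), sized 1 (reg m rT),
  sized 1 (reg m rS) & sized 1 (reg m rE)] by split; apply: sz.
move: offlen; rewrite !inE => /orP[] /eqP[? ?]; subst off len; rewrite /push;
  (symex; symex; symex => c1; [symex => c2; [symex; symex|]|]).
all: rewrite /jump /clear /f /o /l /=;
  (split=> //; [case: ifP => // /orP[]|case: ifP => // /orP[]]; lra).
Qed.

(** Two conflict tests in sequence, with [t1] the time between them; the scan advances by one entry,
    two cells, only if both pass. The cost 50 is a generous bound. *)
Lemma scan_body_ok m (base c : nat) f t t1 :
  reg m rZero = 0 -> reg m rOne = 1 -> reg m rBase = base%:R ->
  reg m rI = c%:R -> reg m rT = t -> mem m c = f.1 -> mem m c.+1 = f.2 ->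
  (base <= X)%N -> (c.+2 <= X)%N ->
  (forall r, r \in [:: rA; rAL; rB; rT] -> sized 1 (reg m r)) ->
  sized 1 f.1 -> sized 1 f.2 ->
  sized 1 t1 -> t1 = jump 0 (reg m rA) f t ->
  ok 50 scan_body m (fun m' =>
    reg m' rT = jump (reg m rAL) (reg m rB) f t1 /\
    reg m' rI = if clear 0 (reg m rA) f t && clear (reg m rAL) (reg m rB) f t1
                then c.+2%:R else base%:R).
Proof.
move=> e0 e1 eb ei et ec ec1 bX cX sz s1 s2 st1 t1E.
have z0 : sized 1 (0 : rat) by apply: (@sized_nat D X 0).
have [sa sal sB sT] : [/\ sized 1 (reg m rA), sized 1 (reg m rAL),
  sized 1 (reg m rB) & sized 1 (reg m rT)] by split; apply: sz.
have s0 : sized 1 (reg m rZero) by rewrite e0.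
have so : sized 1 (reg m rOne) by rewrite e1; apply: (@sized_nat D X 1); lia.
have sb : sized 1 (reg m rBase) by rewrite eb; apply: sized_nat.
have sI : sized 1 (reg m rI) by rewrite ei; apply: sized_nat; lia.
have sc : sized 1 (mem m c) by rewrite ec.
have sc1 : sized 1 (mem m c.+1) by rewrite ec1.
have ei1 : reg m rI + reg m rOne = c.+1%:R by rewrite ei e1 natr1.
apply: (@ok_weaken _ (steps fetch + (steps (push rZero rA) +
  (steps (push rAL rB) + steps (Add rI rNext rZero))))) => //; last by move=> ?; apply.
apply: ok_seq; apply: wp_ok.
access c ei.
symex.
access c.+1 ei1.
symex.
apply: ok_seq.
set m1 := State _ _.
have sz1 r : r \in [:: rZero; rBase; rA; rAL; rB; rT; rS; rE] -> sized 1 (reg m1 r).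
  by rewrite !inE => /or4P[|||/or4P[||| /orP[]]] /eqP->; rewrite /m1 /= ?updE.
apply: ok_weaken (ok_frame (@push_ok m1 rZero rA isT sz1)) (leqnn _) _ => m2 [[t2 n2] fr2].
apply: ok_seq.
have {t2}t2 : reg m2 rT = t1.
  by rewrite t2 t1E /m1 /= ?updE /= e0 et ec ec1 -surjective_pairing.
have {n2}n2 : reg m2 rNext = if clear 0 (reg m rA) f t then c.+2%:R else base%:R.
  rewrite n2 /m1 /= ?updE /= et ec ec1 e0 e1 eb ei -surjective_pairing addr0.
  by rewrite -!natr1 -addrA.
have sz2 r : r \in [:: rZero; rBase; rA; rAL; rB; rT; rS; rE] -> sized 1 (reg m2 r).
  rewrite !inE => /or4P[|||/or4P[||| /orP[]]] /eqP->; rewrite ?t2 //;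
  by rewrite fr2 // /m1 /= ?updE.
apply: ok_weaken (ok_frame (@push_ok m2 rAL rB isT sz2)) (leqnn _) _ => m3 [[t3 n3] fr3].
have f3 r : r \notin [:: rX; rY; rT; rNext] -> reg m3 r = reg m1 r.
  by move=> rW; rewrite fr3 ?fr2.
have Ez : reg m3 rZero = 0 by rewrite f3 // /m1 /= ?updE /= e0.
have f2 : (reg m2 rS, reg m2 rE) = f.
  by rewrite !fr2 // /m1 /= ?updE /= ec ec1 -surjective_pairing.
have En : reg m3 rNext = if clear 0 (reg m rA) f t &&
    clear (reg m rAL) (reg m rB) f t1 then c.+2%:R else base%:R.
  rewrite n3 f2 t2 n2 !fr2 // /m1 /= ?updE /= e0 eb addr0.
  by case: (clear 0); case: (clear (reg m rAL)).
have sn : sized 1 (reg m3 rNext).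
  by rewrite En; case: ifP => _; apply: sized_nat.
have sz3 : sized 1 (reg m3 rZero) by rewrite Ez.
apply: wp_ok; symex; split.
  by rewrite t3 f2 t2 !fr2 // /m1 /= ?updE.
by rewrite Ez En addr0.
Qed.

Lemma earliest_ok m0 (base : nat) (F : seq (rat * rat)) (a al b U : rat) :
  reg m0 rZero = 0 -> reg m0 rOne = 1 -> reg m0 rBase = base%:R ->
  reg m0 rEnd = (base + 2 * size F)%:R ->
  reg m0 rA = a -> reg m0 rAL = al -> reg m0 rB = b ->
  (forall i, (i < size F)%N -> mem m0 (base + 2 * i)%N = (nth (0, 0) F i).1 /\
                               mem m0 (base + 2 * i).+1 = (nth (0, 0) F i).2) ->
  (base + 2 * size F < X)%N ->
  (forall f, f \in F -> [/\ sized 1 f.1, sized 1 f.2 & f.2 <= U]) ->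
  sized 1 a -> sized 1 al -> sized 1 b -> sized 1 U -> 0 <= al -> 0 <= U ->
  let free t := forall f, f \in F -> clear 0 a f t && clear al b f t in
  ok (2 + ((2 * size F).+1 * (size F).+1) * 51) earliest m0 (fun m =>
    [/\ 0 <= reg m rT <= U, reg m rT * D%:R \is a Num.int, free (reg m rT)
      & forall t', 0 <= t' -> free t' -> reg m rT <= t']).
Proof.
move=> e0 e1 eb en ea eal eB cells FX sF sa sal sB sU al0 U0 free.
have s0 : sized 1 (reg m0 rZero) by rewrite e0; apply: (@sized_nat D X 0).
have sb : sized 1 (reg m0 rBase) by rewrite eb; apply: sized_nat; lia.
(* The first [i] entries are clear at [t], and no free time has been skipped. *)
pose good i t := [/\ (i <= size F)%N, 0 <= t <= U, t * D%:R \is a Num.int,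
  (forall f, f \in take i F -> clear 0 a f t && clear al b f t)
  & forall t', 0 <= t' -> free t' -> t <= t'].
(* The variant combines the potential with the number of entries still to be read in the present
   pass. *)
pose Inv k m := [/\ mem m = mem m0, frame (written scan_body) m0 m
  & exists i t, [/\ reg m rI = (base + 2 * i)%:R, reg m rT = t, good i t
    & k = (pot al F t * (size F).+1 + (size F - i))%N]].
have step k m : Inv k m ->
    [/\ (bitsize (reg m rI) <= word D X)%N, (bitsize (reg m rEnd) <= word D X)%N
       & reg m rI < reg m rEnd ->
         ok 50 scan_body m (fun m' => exists2 k', (k' < k)%N & Inv k' m')].
  move=> [memE fr [i [t [ei et [iF tU tD tcl tmin] ->]]]].
  have sI : sized 1 (reg m rI) by rewrite ei; apply: sized_nat; lia.
  have sE : sized 1 (reg m rEnd) by rewrite fr // en; apply: sized_nat; lia.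
  split; try bounded.
  rewrite ei fr // en ltr_nat => lt; have {lt}iF' : (i < size F)%N by lia.
  have [bX cX] : (base <= X)%N /\ ((base + 2 * i).+2 <= X)%N by lia.
  set f := nth (0, 0) F i.
  have fF : f \in F by apply: mem_nth.
  have [c1 c2] := cells i iF'.
  have [s1 s2 fU] := sF f fF.
  (* A jump leads to [f.2 - off], which is at most [U] because [off] is nonnegative, and which keeps
     the denominator within [D]. *)
  have okj off len t' : t' * D%:R \is a Num.int -> sized 1 off -> 0 <= off ->
      0 <= t' <= U ->
      0 <= jump off len f t' <= U /\ jump off len f t' * D%:R \is a Num.int.
    move=> t'D [so _] o0 t'U; have := le_jump off len f t'.
    case: (jumpP off len f t') => [[_ ->]|[_ _ ->]] lj //; split; first by lra.
    by rewrite mulrBl rpredB //; case: s2.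
  have st : sized 1 t by apply: sized_nonneg tD tU sU.
  have [t1U t1D] := okj 0 a t tD (@sized_nat D X 0 isT) (lexx _) tU.
  set t1 := jump 0 a f t in t1U t1D.
  have [t2U t2D] := okj al b t1 t1D sal al0 t1U.
  have eA : reg m rA = a by rewrite fr.
  have eAL : reg m rAL = al by rewrite fr.
  have eB' : reg m rB = b by rewrite fr.
  have tpot := jump_pot a al b t fF.
  have body := @scan_body_ok m base (base + 2 * i) f t t1.
  rewrite eA eAL eB' in body.
  have ro : read_only scan_body by [].
  have {}body : ok 50 scan_body m (fun m' => reg m' rT = jump al b f t1 /\
      reg m' rI = if clear 0 a f t && clear al b f t1
                  then (base + 2 * i).+2%:R else base%:R).
    apply: body; rewrite ?memE //; try by rewrite fr.
      by move=> r; rewrite !inE => /or4P[] /eqP->; rewrite ?eA ?eAL ?eB' ?et.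
    exact: sized_nonneg t1D t1U sU.
  apply: ok_weaken (ok_frame (ok_read_only ro body)) (leqnn _) _.
    move=> m' [[[et' ei'] memE'] fr'].
    set t2 := jump al b f t1 in t2U t2D et'.
    have tmin2 t' : 0 <= t' -> free t' -> t2 <= t'.
      move=> t'0 ft'; have /andP[cl1 cl2] := ft' f fF.
      by do 2 apply: jump_least => //; apply: tmin.
    have Inv' i' : reg m' rI = (base + 2 * i')%:R -> (i' <= size F)%N ->
        (forall g, g \in take i' F -> clear 0 a g t2 && clear al b g t2) ->
        Inv (pot al F t2 * (size F).+1 + (size F - i'))%N m'.
      move=> eI i'F cl; split; first by rewrite memE' memE.
        by move=> r rW; rewrite fr' ?fr.
      by exists i', t2.
    rewrite /= -/t1 -/t2 in tpot; move: tpot ei'.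
    case: ifP => [/andP[cl1 cl2] t2E eI|_ lt eI].
      exists (pot al F t2 * (size F).+1 + (size F - i.+1))%N.
        by rewrite t2E ltn_add2l subnS ltn_predL subn_gt0.
      apply: (Inv' i.+1); [by rewrite eI mulnS addnCA add2n|by []|].
      move=> g; rewrite (take_nth (0, 0)) // mem_rcons inE -/f t2E.
      move: cl2; rewrite /t1 /jump cl1 => cl2.
      by case/predU1P => [->|/tcl //]; rewrite cl1.
    exists (pot al F t2 * (size F).+1 + (size F - 0))%N; first exact: ltn_lex.
    by apply: (Inv' 0%N) => //; rewrite ?muln0 ?addn0 ?take0.
have start : Inv (pot al F 0 * (size F).+1 + (size F - 0))%N
    (State (upd (upd (reg m0) rT 0) rI base%:R) (mem m0)).
  split=> //.
    move=> r rW; rewrite /= !updE.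
    by do 2 (case: eqP => [rE|_]; first by rewrite rE in rW).
  exists 0%N, 0; split=> //=; first by rewrite muln0 addn0.
  by split=> //; rewrite ?take0 ?mul0r ?rpred0.
apply: (@ok_weaken _ (1 + (1 + ((pot al F 0 * (size F).+1 + (size F - 0)).+1 * 51)))).
- apply: ok_seq; apply: (@wp_ok _ (Sub _ _ _)) => /=; symex.
  apply: ok_seq; apply: (@wp_ok _ (Add _ _ _)) => /=; symex.
  rewrite e0 eb subr0 addr0.
  exact: ok_while step _ _ start.
(* The potential starts at no more than [2 * size F], so the loop test is made at most
   [(2 * size F).+1 * (size F).+1] times. *)
- by rewrite addnA leq_add2l leq_mul2r; have := pot_le_size al F 0; nia.
move=> m [[k [memE fr [i [t [ei et [iF tU tD tcl tmin] _]]]]]].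
rewrite ei fr // en ler_nat => le; have iE : i = size F by lia.
by move: tcl; rewrite iE take_size et.
Qed.

End Scan.

(** * Scheduling one job *)

Definition take_job : program := Add rKey rX rZero ;; Add rJ rK rZero.

(* The delay cell of a scheduled job holds -1, and so does rKey as long as no
   unscheduled job has been found. *)
Definition select_body : program :=
  Add rP rK rK ;; Add rP rP rK ;; Add rP rP rOne ;; Read rX rP ;;
  IfLt rX rZero Skip
    (IfLt rKey rZero take_job (IfLt rX rKey take_job Skip)) ;;
  Add rK rK rOne.

Definition select : program :=
  Sub rKey rZero rOne ;; Add rK rZero rZero ;; WhileLt rK rN select_body.

(** The delay is added into [rAL], after which its cell is free to carry the mark -1 of a scheduled
    job. *)
Definition load : program :=
  Add rP rJ rJ ;; Add rP rP rJ ;; Read rA rP ;;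
  Add rP rP rOne ;; Read rAL rP ;; Add rAL rA rAL ;;
  Sub rX rZero rOne ;; Write rP rX ;;
  Add rP rP rOne ;; Read rB rP.

Definition store : program :=
  Add rP r3N rJ ;; Write rP rT ;;
  Write rEnd rT ;; Add rEnd rEnd rOne ;;
  Add rX rT rA ;; Write rEnd rX ;; Add rEnd rEnd rOne ;;
  Add rX rT rAL ;; Write rEnd rX ;; Add rEnd rEnd rOne ;;
  Add rX rX rB ;; Write rEnd rX ;; Add rEnd rEnd rOne.

Definition round : program := select ;; load ;; earliest ;; store.

Definition prepare : program :=
  Const rOne 1 ;; Add r3N rN rN ;; Add r3N r3N rN ;; Add rBase r3N rN ;;
  Add rEnd rBase rZero ;; Add rLimit rBase rBase.

Definition scheduler : program := prepare ;; WhileLt rEnd rLimit round.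

(** * Selecting, loading and storing a job *)

Section Scheduler.
Variables D X : nat.
Hypothesis D_gt0 : (0 < D)%N.
Local Notation sized := (sized D X).
Local Notation ok := (ok (word D X)).

Lemma load_ok m j : reg m rZero = 0 -> reg m rOne = 1 -> reg m rJ = j%:R ->
  (3 * j + 2 <= X)%N ->
  (forall i, (i < 3)%N -> sized 1 (mem m (3 * j + i))) ->
  ok (steps load) load m (fun m' =>
    [/\ reg m' rA = mem m (3 * j), reg m' rAL = mem m (3 * j) + mem m (3 * j).+1,
        reg m' rB = mem m (3 * j).+2
      & mem m' = upd (mem m) (3 * j).+1 (-1)]).
Proof.
move=> e0 e1 ej jX sm.
have s0 : sized 1 (reg m rZero) by rewrite e0; apply: (@sized_nat D X 0).
have so : sized 1 (reg m rOne) by rewrite e1; apply: (@sized_nat D X 1); lia.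
have sj : sized 1 (reg m rJ) by rewrite ej; apply: sized_nat; lia.
have [sa sl sb] : [/\ sized 1 (mem m (3 * j)), sized 1 (mem m (3 * j).+1)
    & sized 1 (mem m (3 * j).+2)].
  by have := sm 0%N isT; have := sm 1%N isT; have := sm 2%N isT;
    rewrite addn0 addn1 addn2.
have j3 : reg m rJ + reg m rJ + reg m rJ = (3 * j)%:R by rewrite ej; ring.
have j4 : reg m rJ + reg m rJ + reg m rJ + reg m rOne = (3 * j).+1%:R.
  by rewrite j3 e1 natr1.
have j5 : reg m rJ + reg m rJ + reg m rJ + reg m rOne + reg m rOne = (3 * j).+2%:R.
  by rewrite j4 e1 natr1.
apply: wp_ok; symex; symex.
access (3 * j)%N j3.
symex.
access (3 * j).+1 j4.
symex; symex.
access (3 * j).+1 j4.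
symex.
have ne : ((3 * j).+2 == (3 * j).+1) = false by lia.
rewrite ?wpE; exists (3 * j).+2; rewrite /= updE ne; split; [exact: j5|bounded|bounded|].
by rewrite /= ?updE /=; split=> //; rewrite e0 e1 sub0r.
Qed.

Lemma store_ok m (j base e : nat) :
  reg m rOne = 1 -> reg m r3N = base%:R -> reg m rJ = j%:R -> reg m rEnd = e%:R ->
  (base + j <= X)%N -> (e + 4 <= X)%N -> 
  (forall r, r \in [:: rA; rAL; rB; rT] -> sized 1 (reg m r)) ->
  let t := reg m rT in
  ok (steps store) store m (fun m' =>
    reg m' rEnd = (e + 4)%:R /\
    mem m' = upd (upd (upd (upd (upd (mem m) (base + j) t) e t)
      e.+1 (t + reg m rA)) e.+2 (t + reg m rAL)) e.+3 (t + reg m rAL + reg m rB)).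
Proof.
move=> e1 eb ej ee bX eX sz t.
have so : sized 1 (reg m rOne) by rewrite e1; apply: (@sized_nat D X 1); lia.
have sj : sized 1 (reg m rJ) by rewrite ej; apply: sized_nat; lia.
have sb : sized 1 (reg m r3N) by rewrite eb; apply: sized_nat; lia.
have se : sized 1 (reg m rEnd) by rewrite ee; apply: sized_nat; lia.
have [sa sal sB sT] : [/\ sized 1 (reg m rA), sized 1 (reg m rAL),
  sized 1 (reg m rB) & sized 1 (reg m rT)] by split; apply: sz.
have a0 : reg m r3N + reg m rJ = (base + j)%:R by rewrite eb ej natrD.
have a1 : reg m rEnd + reg m rOne = e.+1%:R by rewrite ee e1 natr1.
have a2 : reg m rEnd + reg m rOne + reg m rOne = e.+2%:R by rewrite a1 e1 natr1.
have a3 : reg m rEnd + reg m rOne + reg m rOne + reg m rOne = e.+3%:R.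
  by rewrite a2 e1 natr1.
apply: wp_ok; symex.
access (base + j)%N a0.
access e ee.
symex; symex.
access e.+1 a1.
symex; symex.
access e.+2 a2.
symex; symex.
access e.+3 a3.
symex; split=> //.
by rewrite a3 e1 natr1 addn4.
Qed.

Lemma select_ok m (n : nat) (L : 'I_n -> rat) (js : seq 'I_n) :
  reg m rZero = 0 -> reg m rOne = 1 -> reg m rN = n%:R -> (3 * n < X)%N ->
  (forall j, 0 <= L j /\ sized 1 (L j)) ->
  (forall j : 'I_n, mem m (3 * j).+1 = if j \in js then -1 else L j) ->
  (exists j, j \notin js) ->
  ok (2 + n.+1 * 20) select m (fun m' => exists j : 'I_n,
    [/\ reg m' rJ = j%:R, j \notin js & forall k, k \notin js -> L j <= L k]).
Proof.
move=> e0 e1 eN nX L0 cells [j0 j0js].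
(* Delays are nonnegative, so the sign of [rKey] tells whether a candidate has been found among the
   first [k] jobs. *)
pose found k m' :=
  (reg m' rKey = -1 /\ forall j : 'I_n, (j < k)%N -> j \in js) \/
  (exists j : 'I_n, [/\ reg m' rKey = L j, reg m' rJ = j%:R, j \notin js
     & forall i : 'I_n, (i < k)%N -> i \notin js -> L j <= L i]).
pose Inv d m' := [/\ mem m' = mem m, frame (written select_body) m m'
  & exists k, [/\ (k <= n)%N, d = (n - k)%N, reg m' rK = k%:R & found k m']].
have s1 : sized 1 (1 : rat) by apply: (@sized_nat D X 1); lia.
have s0 : sized 1 (0 : rat) by apply: (@sized_nat D X 0).
have sN1 : sized 1 (-1).
  by case: s1 => ? ?; split; rewrite ?mulNr ?rpredN ?normrN.
have step d m' : Inv d m' ->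
    [/\ (bitsize (reg m' rK) <= word D X)%N, (bitsize (reg m' rN) <= word D X)%N
       & reg m' rK < reg m' rN ->
         ok (steps select_body) select_body m'
           (fun m'' => exists2 d', (d' < d)%N & Inv d' m'')].
  move=> [memE fr [k [kn -> eK fnd]]].
  have sK : sized 1 (reg m' rK) by rewrite eK; apply: sized_nat; lia.
  have sN : sized 1 (reg m' rN) by rewrite fr // eN; apply: sized_nat; lia.
  split; try bounded.
  rewrite eK fr // eN ltr_nat => kn'.
  have Ez : reg m' rZero = 0 by rewrite fr.
  have Eo : reg m' rOne = 1 by rewrite fr.
  have sz : sized 1 (reg m' rZero) by rewrite Ez.
  have so : sized 1 (reg m' rOne) by rewrite Eo.
  have sKey : sized 1 (reg m' rKey).
    by case: fnd => [[->]|[j [-> _ _ _]]] //; case: (L0 j).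
  have ek : mem m' (3 * k).+1 = if Ordinal kn' \in js then -1 else L (Ordinal kn').
    by rewrite memE -cells.
  have sx : sized 1 (mem m' (3 * k).+1).
    by rewrite ek; case: ifP => // _; case: (L0 (Ordinal kn')).
  have k1 : reg m' rK + reg m' rK + reg m' rK + reg m' rOne = (3 * k).+1%:R.
    by rewrite eK Eo; ring.
  have L0k := (L0 (Ordinal kn')).1.
  have ltS (i : 'I_n) : (i < k.+1)%N -> (i < k)%N \/ i = Ordinal kn'.
    rewrite ltnS leq_eqVlt => /orP[/eqP ik|]; last by left.
    by right; apply: val_inj.
  have fin m'' : mem m'' = mem m' -> frame (written select_body) m' m'' ->
      reg m'' rK = k.+1%:R -> found k.+1 m'' ->
      exists2 d', (d' < n - k)%N & Inv d' m''.
    move=> memE' fr' eK' fnd'; exists (n - k.+1)%N; first by rewrite subnS ltn_predL subn_gt0.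
    split; [by rewrite memE'|by move=> r rW; rewrite fr' ?fr|by exists k.+1].
  have ro : read_only select_body by [].
  suff H : ok (steps select_body) select_body m' (fun m'' =>
      reg m'' rK = k.+1%:R /\ found k.+1 m'').
    apply: ok_weaken (ok_frame (ok_read_only ro H)) (leqnn _) _.
    by move=> m'' [[[? ?] ?] ?]; apply: fin.
  apply: wp_ok; symex; symex; symex.
  access (3 * k).+1 k1.
  rewrite ek; rewrite ek in sx.
  symex.
  -
    case: ifP => kjs; last by rewrite Ez => ?; lra.
    move=> _; symex; split; first by rewrite eK Eo natr1.
    case: fnd => [[key none]|[j [key ej jjs jmin]]]; [left|right].
      by split=> // i /ltS[/none|->].
    by exists j; split=> // i /ltS[/jmin|->] //; rewrite kjs.
  - rewrite Ez; case: ifP => kjs; first by rewrite leNgt ltrN10.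
    have chosen m'' : reg m'' rKey = L (Ordinal kn') + 0 -> reg m'' rJ = k%:R + 0 ->
        (forall i : 'I_n, (i < k)%N -> i \notin js -> L (Ordinal kn') <= L i) ->
        found k.+1 m''.
      rewrite !addr0 => key ej least; right; exists (Ordinal kn'); split=> //.
        by rewrite kjs.
      by move=> i /ltS[/least|->].
    rewrite Ez in sz.
    have sL : sized 1 (L (Ordinal kn')) by case: (L0 (Ordinal kn')).
    move=> _; split; try bounded; rewrite ?Ez //.
    + move=> key0; symex; symex; symex.
      split; first by rewrite eK Eo natr1.
      apply: chosen => //=; rewrite ?updE /= ?eK ?Ez //.
      case: fnd => [[_ none] i /none ->//|[j [key _ _ _]]].
      by move: key0; rewrite key; have := (L0 j).1; lra.
    + move=> key0; symex => [xkey|keyx].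
        symex; symex; symex; split; first by rewrite eK Eo natr1.
        apply: chosen => //=; rewrite ?updE /= ?eK ?Ez //.
        case: fnd => [[_ none] i /none ->//|[j [key _ _ jmin]] i ik ijs].
        by have := jmin i ik ijs; lra.
      symex; split; first by rewrite eK Eo natr1.
      case: fnd => [[key _]|[j [key ej jjs jmin]]]; first by lra.
      right; exists j; split=> // i /ltS[/jmin //|-> _].
      by rewrite -key.
have start : Inv (n - 0)%N (State (upd (upd (reg m) rKey (-1)) rK 0) (mem m)).
  split=> //.
    move=> r rW; rewrite /= !updE.
    by do 2 (case: eqP => [rE|_]; first by rewrite rE in rW).
  by exists 0%N; split=> //; left; split.
apply: (@ok_weaken _ (1 + (1 + (n - 0).+1 * (steps select_body).+1))).
- have sz : sized 1 (reg m rZero) by rewrite e0.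
  have so : sized 1 (reg m rOne) by rewrite e1.
  apply: ok_seq; apply: (@wp_ok _ (Sub _ _ _)) => /=; symex.
  apply: ok_seq; apply: (@wp_ok _ (Add _ _ _)) => /=; symex.
  rewrite e0 e1 sub0r addr0.
  exact: ok_while step _ _ start.
- by rewrite subn0 addnA leq_add2l leq_mul2l.
move=> m' [[d [memE fr [k [kn _ eK fnd]]]]].
rewrite eK fr // eN ler_nat => nk; case: fnd => [[_ none]|[j [_ ej jjs jmin]]].
  by have := none j0 (leq_trans (ltn_ord j0) nk); rewrite (negPf j0js).
exists j; split=> // i; apply: jmin; exact: leq_trans (ltn_ord i) nk.
Qed.

End Scheduler.

(** * The memory after one round *)

Section RoundMemory.
Variables (f : nat -> rat) (n s j : nat) (t0 t1 t2 t3 : rat).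
Hypotheses (j_n : (j < n)%N) (s_n : (s < n)%N).

(** The six writes of a round: the mark of job [j], its starting time, and two table entries. The
    bounds on [j] and [s] keep the memory regions apart. *)
Definition round_mem : nat -> rat :=
  let e := (4 * n + 4 * s)%N in
  upd (upd (upd (upd (upd (upd f (3 * j).+1 (-1)) (3 * n + j) t0) e t0)
    e.+1 t1) e.+2 t2) e.+3 t3.

Ltac lookup := rewrite /round_mem !updE;
  repeat (case: eqP => ? //; try lia); try (congr (f _); lia).

Lemma round_mem_output i : (i < n)%N ->
  round_mem (3 * n + i) = if i == j then t0 else f (3 * n + i)%N.
Proof. by move=> i_n; lookup. Qed.

Lemma round_mem_first i : (i < n)%N -> round_mem (3 * i) = f (3 * i)%N.
Proof. by move=> i_n; lookup. Qed.

Lemma round_mem_delay i : (i < n)%N ->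
  round_mem (3 * i).+1 = if i == j then -1 else f (3 * i).+1.
Proof. by move=> i_n; lookup. Qed.

Lemma round_mem_second i : (i < n)%N -> round_mem (3 * i).+2 = f (3 * i).+2.
Proof. by move=> i_n; lookup. Qed.

Lemma round_mem_old x : (x < 4 * s)%N -> round_mem (4 * n + x) = f (4 * n + x)%N.
Proof. by move=> x_s; lookup. Qed.

Lemma round_mem_new : let e := (4 * n + 4 * s)%N in
  [/\ round_mem e = t0, round_mem e.+1 = t1, round_mem e.+2 = t2
    & round_mem e.+3 = t3].
Proof. by move=> e; split; lookup. Qed.

End RoundMemory.

(** * The invariant of the scheduler *)

Section Correctness.
Variables (n : nat) (I : instance rat n).
Local Notation a := (first_time I).
Local Notation L := (delay I).
Local Notation b := (second_time I).
Implicit Types (S : 'I_n -> rat) (js : seq 'I_n).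

Definition blocks S js : seq (rat * rat) :=
  flatten [seq [:: (S j, S j + a j); (S j + a j + L j, S j + a j + L j + b j)]
          | j <- js].

Lemma size_blocks S js : size (blocks S js) = (2 * size js)%N.
Proof. by elim: js => //= j js IH; rewrite -/(blocks S js) IH mulnS. Qed.

Lemma blocks_rcons S js j : blocks S (rcons js j) = blocks S js ++
  [:: (S j, S j + a j); (S j + a j + L j, S j + a j + L j + b j)].
Proof. by rewrite /blocks map_rcons flatten_rcons. Qed.

Lemma eq_blocks S S' js : {in js, S =1 S'} -> blocks S js = blocks S' js.
Proof.
by move=> eqS; congr flatten; apply/eq_in_map => j js_j; rewrite eqS.
Qed.

Lemma mem_blocks S js f : f \in blocks S js ->
  exists2 u : 'I_n * bool, u.1 \in js & f = (task_start I S u, task_end I S u).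
Proof.
move=> /flattenP[s /mapP[j js_j ->]]; rewrite !inE => /orP[]/eqP ->.
  by exists (j, false).
by exists (j, true).
Qed.

Lemma task_in_blocks S js u : u.1 \in js ->
  (task_start I S u, task_end I S u) \in blocks S js.
Proof.
move=> u_js; apply/flattenP; eexists; first by apply/mapP; exists u.1.
by rewrite /task_start /task_end !inE; case: u.2; rewrite eqxx ?orbT.
Qed.

Lemma fits_blocks S js j t : fits I S [set i in js] j t <->
  0 <= t /\ (forall f, f \in blocks S js ->
               clear 0 (a j) f t && clear (a j + L j) (b j) f t).
Proof.
rewrite fitsP /clear addr0; split=> -[t0 ft]; split=> //.
  move=> f /mem_blocks[u u_js ->] /=; rewrite addrA.
  by apply: ft; rewrite inE.
by move=> u; rewrite inE => /(task_in_blocks S)/ft /=; rewrite addrA.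
Qed.

(** Time needed to run the jobs one after the other, delays included: an a priori bound on all
    completion times. *)
Definition load_time js : rat := \sum_(j <- js) (a j + L j + b j).

(** [js] lists the scheduled jobs in the order of their selection. [inv_bound] keeps the numbers
    short, and [inv_least] is what keeps the list sorted when a job is appended. *)
Record scheduler_invariant (D : nat) js (m : state) : Prop := Invariant {
  inv_const : [/\ reg m rZero = 0, reg m rOne = 1, reg m rN = n%:R
                & reg m r3N = (3 * n)%:R];
  inv_pointer : [/\ reg m rBase = (4 * n)%:R, reg m rLimit = (8 * n)%:R
                  & reg m rEnd = (4 * n + 4 * size js)%:R];
  inv_uniq : uniq js;
  inv_first : forall j : 'I_n, mem m (3 * j) = a j;
  inv_delay : forall j : 'I_n, mem m (3 * j).+1 = if j \in js then -1 else L j;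
  inv_second : forall j : 'I_n, mem m (3 * j).+2 = b j;
  inv_blocks : forall i, (i < 2 * size js)%N ->
    mem m (4 * n + 2 * i) = (nth (0, 0) (blocks (output m) js) i).1 /\
    mem m (4 * n + 2 * i).+1 = (nth (0, 0) (blocks (output m) js) i).2;
  inv_bound : forall j, j \in js -> [/\ 0 <= output m j,
    completion I (output m) j <= load_time js & output m j * D%:R \is a Num.int];
  inv_sorted : sorted (relpre L <=%R) js;
  inv_least : forall i j, i \in js -> j \notin js -> L i <= L j;
  inv_greedy : greedy I (output m) js
}.

Variables D X : nat.
Hypothesis D_gt0 : (0 < D)%N.
Hypothesis X_ge : (8 * n + 2 < X)%N.
Hypothesis input_int : forall j, [/\ a j * D%:R \is a Num.int,
  L j * D%:R \is a Num.int & b j * D%:R \is a Num.int].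
Hypothesis input_le : \sum_j (a j + L j + b j) <= X%:R.
Local Notation sized := (sized D X).
Local Notation ok := (ok (word D X)).

Let job_ge0 j : 0 <= a j + L j + b j.
Proof.
by have := first_time_gt0 I j; have := delay_ge0 I j; have := second_time_gt0 I j; lra.
Qed.

Lemma load_time_le js : uniq js -> load_time js <= X%:R.
Proof.
move=> ujs; apply: le_trans input_le; rewrite /load_time big_uniq //=.
by rewrite [leRHS](bigID (fun j => j \in js)) /= lerDl sumr_ge0.
Qed.

Lemma sized_le x : x * D%:R \is a Num.int -> 0 <= x <= X%:R -> sized 1 x.
Proof. by move=> ix /andP[x0 xX]; split; rewrite // mul1r ger0_norm. Qed.

Lemma job_le j : a j + L j + b j <= X%:R.
Proof.
by have := @load_time_le [:: j] isT; rewrite /load_time big_seq1.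
Qed.

Lemma sized_input j :
  [/\ sized 1 (a j), sized 1 (L j), sized 1 (b j) & sized 1 (a j + L j)].
Proof.
have [ai li bi] := input_int j; have := job_le j.
have a0 := first_time_gt0 I j; have l0 := delay_ge0 I j.
have b0 := second_time_gt0 I j.
by move=> jX; split; apply: sized_le; rewrite ?mulrDl ?rpredD //; apply/andP; lra.
Qed.

(** Since [t] is at most the load of [js], the new job completes within the extended load; being
    least among the free times of the table, [t] is the greedy choice. *)
Lemma scheduler_invariant_rcons js m m' j t :
  scheduler_invariant D js m -> (size js < n)%N -> j \notin js ->
  (forall k, k \notin js -> L j <= L k) ->
  0 <= t <= load_time js -> t * D%:R \is a Num.int ->
  let free t := forall f, f \in blocks (output m) js ->
    clear 0 (a j) f t && clear (a j + L j) (b j) f t in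
  free t -> (forall t', 0 <= t' -> free t' -> t <= t') ->
  mem m' = round_mem (mem m) n (size js) j t (t + a j) (t + (a j + L j))
             (t + (a j + L j) + b j) ->
  reg m' rEnd = (4 * n + 4 * size js + 4)%:R ->
  (forall r, r \in [:: rN; rZero; rOne; r3N; rBase; rLimit] -> reg m' r = reg m r) ->
  scheduler_invariant D (rcons js j) m'.
Proof.
move=> [[e0 e1 eN e3] [eB eLim eE] ujs ia il ib iblocks ibound isrt ileast igr].
move=> js_n jjs jmin tU tD free tfree tmin memE endE regE.
have jn : (j < n)%N by [].
have outE (i : 'I_n) : output m' i = if i == j then t else output m i.
  by rewrite /output memE round_mem_output.
have eqS : {in js, output m =1 output m'}.
  by move=> i i_js; rewrite outE; case: eqP => // ij; rewrite ij (negPf jjs) in i_js.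
have outj : output m' j = t by rewrite outE eqxx.
have loadE : load_time (rcons js j) = load_time js + (a j + L j + b j).
  by rewrite /load_time big_rcons /= addrC.
split.
- by split; rewrite regE.
- by split; [rewrite regE|rewrite regE|rewrite endE size_rcons mulnSr addnA].
- by rewrite rcons_uniq jjs.
- by move=> i; rewrite memE round_mem_first.
- move=> i; rewrite memE round_mem_delay // mem_rcons inE -val_eqE.
  by case: eqP => //=; rewrite il.
- by move=> i; rewrite memE round_mem_second.
- rewrite blocks_rcons -(eq_blocks eqS) outj size_rcons => i i_lt.
  have [n0 n1 n2 n3] := round_mem_new (mem m) t (t + a j) (t + (a j + L j))
    (t + (a j + L j) + b j) jn js_n.
  have old := round_mem_old (mem m) t (t + a j) (t + (a j + L j))
    (t + (a j + L j) + b j) jn js_n.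
  rewrite nth_cat size_blocks memE; case: ltnP => i_js.
    have [lt1 lt2] : (2 * i < 4 * size js)%N /\ ((2 * i).+1 < 4 * size js)%N.
      by clear -i_js; lia.
    by rewrite -addnS !old // addnS; apply: iblocks.
  have [->|->] : i = (2 * size js)%N \/ i = (2 * size js).+1.
  + by clear -i_js i_lt; lia.
  + by rewrite subnn mulnA n0 n1.
  rewrite subSnn mulnS mulnA addnCA add2n n2 n3 /=.
  by rewrite !addrA.
- move=> i; rewrite mem_rcons inE loadE /completion outE => /predU1P[->|i_js].
    by rewrite eqxx; case/andP: tU => t0 tU; split=> //; lra.
  have [S0 C_le SD] := ibound i i_js.
  rewrite ifN; last by apply: contraNneq jjs => <-.
  by split=> //; apply: le_trans C_le _; rewrite lerDl job_ge0.
- have leT : transitive (relpre L <=%R) by move=> x y z; apply: le_trans.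
  rewrite sorted_pairwise // pairwise_rcons -sorted_pairwise // isrt andbT.
  by apply/allP => i i_js; apply: ileast.
- move=> i k; rewrite !mem_rcons !inE negb_or => /predU1P[->|i_js] /andP[kj kjs].
    exact: jmin.
  exact: ileast.
apply: (greedy_rcons jjs eqS igr); rewrite /asap outj.
have eqS' : {in [set i in js], output m =1 output m'}.
  by move=> i; rewrite inE; apply: eqS.
have eqS'' : {in [set i in js], output m' =1 output m}.
  by move=> i i_js; rewrite eqS'.
split; first by apply/(eq_fits eqS')/fits_blocks; case/andP: tU.
by move=> t' /(eq_fits eqS'')/fits_blocks[t'0 ft']; apply: tmin.
Qed.

Lemma round_ok js m : scheduler_invariant D js m -> (size js < n)%N ->
  ok (2 + n.+1 * 20 + (steps load +
      (2 + ((4 * n).+1 * (2 * n).+1) * 51 + steps store))) round m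
     (fun m' => exists2 j, j \notin js & scheduler_invariant D (rcons js j) m').
Proof.
move=> inv js_n.
have [[e0 e1 eN e3] [eB eLim eE] ujs ia il ib iblocks ibound isrt ileast igr] := inv.
have XN : (3 * n < X)%N by clear -X_ge; lia.
have sl j : sized 1 (L j) by have [] := sized_input j.
have [s1 s0] : sized 1 1 /\ sized 1 0.
  by split; [apply: (@sized_nat D X 1)|apply: (@sized_nat D X 0)] => //;
    apply: leq_trans XN.
have sN1 : sized 1 (-1).
  by case: s1 => ? ?; split; rewrite ?mulNr ?rpredN ?normrN.
(* Fewer than [n] jobs are listed, so the selection cannot come out empty. *)
have [j0 j0js] : exists j, j \notin js.
  have [/forallP all_js|/forallPn[j]] := boolP [forall j, j \in js]; last by exists j.
  have : (#|'I_n| <= size js)%N.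
    by apply: leq_trans (card_size js); apply/subset_leq_card/subsetP.
  by rewrite card_ord leqNgt js_n.
apply: ok_seq.
have roS : read_only select by [].
apply: ok_weaken (ok_frame (ok_read_only roS (select_ok D_gt0 e0 e1 eN XN
  (fun j => conj (delay_ge0 I j) (sl j)) il (ex_intro _ j0 j0js)))) (leqnn _) _.
move=> m1 [[[j [ej jjs jmin]] mem1] fr1].
have m1r r : r \notin written select -> reg m1 r = reg m r by exact: fr1.
have [z1 o1] : reg m1 rZero = 0 /\ reg m1 rOne = 1 by rewrite !m1r.
have [sa _ sb sal] := sized_input j.
have jn : (j < n)%N by [].
have jX : (3 * j + 2 <= X)%N by clear -jn XN; lia.
have cells i : (i < 3)%N -> sized 1 (mem m1 (3 * j + i)).
  case: i => [|[|[|i]]] // _; rewrite mem1 ?addn0 ?addn1 ?addn2 ?ia ?il ?ib //.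
  by rewrite (negPf jjs).
apply: ok_seq.
apply: ok_weaken (ok_frame (load_ok D_gt0 z1 o1 ej jX cells)) (leqnn _) _.
move=> m2 [[eA eAL eBt mem2] fr2].
have m2r r : r \notin written select -> r \notin written load -> reg m2 r = reg m r.
  by move=> r1 r2; rewrite fr2 ?m1r.
rewrite mem1 in eA eAL eBt mem2.
rewrite ia il ib (negPf jjs) in eA eAL eBt.
set S := output m in iblocks ibound igr.
have out_le i : i \in js -> completion I S i <= load_time js by case/ibound.
have start_ge0 i : i \in js -> 0 <= S i by case/ibound.
have Uint x : 0 <= x <= load_time js -> x * D%:R \is a Num.int -> sized 1 x.
  move=> /andP[x0 xU] xD; apply: sized_le => //; rewrite x0.
  exact: le_trans xU (load_time_le ujs).
have load_int : load_time js * D%:R \is a Num.int.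
  rewrite mulr_suml rpred_sum // => i _; have [? ? ?] := input_int i.
  by rewrite !mulrDl !rpredD.
have load_ge0 : 0 <= load_time js by apply: sumr_ge0.
have blk f : f \in blocks S js ->
    [/\ sized 1 f.1, sized 1 f.2 & f.2 <= load_time js].
  move=> /mem_blocks[u u_js ->] /=.
  have [S0 C_le SD] := ibound _ u_js.
  have [ai li bi] := input_int u.1.
  have uC := task_end_le_completion I S u.
  have uU := le_trans uC C_le.
  have lt := task_start_lt_end I S u.
  have st0 : 0 <= task_start I S u.
    rewrite /task_start; case: u.2 => //.
    by have := first_time_gt0 I u.1; have := delay_ge0 I u.1; lra.
  have stD : task_start I S u * D%:R \is a Num.int.
    by rewrite /task_start; case: u.2; rewrite ?mulrDl ?rpredD.
  have enD : task_end I S u * D%:R \is a Num.int.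
    by rewrite /task_end; case: u.2; rewrite ?mulrDl ?rpredD.
  by split=> //; apply: Uint => //; apply/andP; lra.
have mem2_old x : (x < 4 * size js)%N -> mem m2 (4 * n + x) = mem m (4 * n + x)%N.
  by move=> _; rewrite mem2 updE; case: eqP => // e; exfalso; clear -e jn; lia.
have enE : reg m2 rEnd = (4 * n + 2 * size (blocks S js))%:R.
  by rewrite m2r // eE size_blocks mulnA.
have cells2 i : (i < size (blocks S js))%N ->
    mem m2 (4 * n + 2 * i)%N = (nth (0, 0) (blocks S js) i).1 /\
    mem m2 (4 * n + 2 * i).+1 = (nth (0, 0) (blocks S js) i).2.
  rewrite size_blocks => i_s; rewrite -addnS !mem2_old; try by clear -i_s; lia.
  by rewrite addnS; apply: iblocks.
have FX : (4 * n + 2 * size (blocks S js) < X)%N.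
  by rewrite size_blocks; clear -X_ge js_n; lia.
have al0 : 0 <= a j + L j.
  by have := first_time_gt0 I j; have := delay_ge0 I j; lra.
apply: ok_seq.
have [z2 o2] : reg m2 rZero = 0 /\ reg m2 rOne = 1 by rewrite !m2r.
have b2 : reg m2 rBase = (4 * n)%:R by rewrite m2r.
have roE : read_only earliest by [].
(* The bound [U] of the search is [load_time js], by which every scheduled task has ended. *)
apply: ok_weaken (ok_frame (ok_read_only roE (earliest_ok D_gt0 z2 o2 b2 enE eA eAL
  eBt cells2 FX blk sa sal sb (Uint _ _ load_int) al0 load_ge0))) _ _.
- by rewrite load_ge0 lexx.
- by rewrite size_blocks; clear -js_n; nia.
move=> m3 [[[tU tD tfree tmin] mem3] fr3].
set t := reg m3 rT in tU tD tfree tmin.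
have m3r r : r \notin written select -> r \notin written load ->
    r \notin written earliest -> reg m3 r = reg m r.
  by move=> r1 r2 r3; rewrite fr3 ?m2r.
have o3 : reg m3 rOne = 1 by rewrite m3r.
have b3 : reg m3 r3N = (3 * n)%:R by rewrite m3r.
have j3 : reg m3 rJ = j%:R by rewrite fr3 // fr2.
have e3' : reg m3 rEnd = (4 * n + 4 * size js)%:R by rewrite m3r.
have a3 : reg m3 rA = a j by rewrite fr3.
have al3 : reg m3 rAL = a j + L j by rewrite fr3.
have bt3 : reg m3 rB = b j by rewrite fr3.
have bX : (3 * n + j <= X)%N by clear -X_ge jn; lia.
have eX : (4 * n + 4 * size js + 4 <= X)%N by clear -X_ge js_n; lia.
have sz3 r : r \in [:: rA; rAL; rB; rT] -> sized 1 (reg m3 r).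
  rewrite !inE => /or4P[] /eqP->; rewrite ?a3 ?al3 ?bt3 //.
  exact: Uint.
apply: ok_weaken (ok_frame (store_ok D_gt0 o3 b3 j3 e3' bX eX sz3)) (leqnn _) _.
move=> m4 [[e4 mem4] fr4].
have m4r r : r \notin written select -> r \notin written load ->
    r \notin written earliest -> r \notin written store -> reg m4 r = reg m r.
  by move=> r1 r2 r3 r4; rewrite fr4 ?m3r.
exists j => //.
rewrite -/t a3 al3 bt3 mem3 mem2 in mem4.
apply: (scheduler_invariant_rcons inv js_n jjs jmin tU tD tfree tmin mem4 e4).
by move=> r; rewrite !inE => /or4P[|||/or3P[]] /eqP->; apply: m4r.
Qed.


End Correctness.

(** * Running time *)

Lemma nth_flatten3 (A T : Type) (x0 : T) (y0 : A) (f : A -> seq T) s i k :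
  (forall y, size (f y) = 3%N) -> (k < 3)%N -> (i < size s)%N ->
  nth x0 (flatten (map f s)) (3 * i + k) = nth x0 (f (nth y0 s i)) k.
Proof.
move=> size_f k3; elim: s i => // y s IH [|i] /= i_s.
  by rewrite muln0 nth_cat size_f k3.
by rewrite nth_cat size_f mulnS -addnA ltnNge leq_addr /= addKn IH.
Qed.

(** * The complete run from the initial state *)

Section InitialState.
Variables (n : nat) (I : instance rat n).

Lemma nth_input (j : 'I_n) k : (k < 3)%N ->
  nth 0 (input I) (3 * j + k) =
  nth 0 [:: first_time I j; delay I j; second_time I j] k.
Proof.
by move=> k3; rewrite /input (nth_flatten3 _ j) ?size_enum_ord // nth_ord_enum.
Qed.

Lemma sum_input : \sum_(x <- input I) x =
  \sum_j (first_time I j + delay I j + second_time I j).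
Proof.
rewrite /input big_flatten big_map big_enum /=.
by apply: eq_bigr => j _; rewrite !big_cons big_nil addr0 addrA.
Qed.

Lemma mem_input (j : 'I_n) : [/\ first_time I j \in input I, delay I j \in input I
  & second_time I j \in input I].
Proof.
have sub x : x \in [:: first_time I j; delay I j; second_time I j] -> x \in input I.
  by move=> xj; apply/flattenP; eexists; [apply/map_f/(mem_enum _ j)|exact: xj].
by split; apply: sub; rewrite !inE eqxx ?orbT.
Qed.

(** [D] is a common denominator of the input, and [X] bounds both the addresses and the sum of the
    input. The variant of the main loop is the number of unscheduled jobs. *)
Lemma scheduler_ok (D X : nat) :
  (0 < D)%N -> (8 * n + 2 < X)%N ->
  (forall x, x \in input I -> x * D%:R \is a Num.int) ->
  \sum_(x <- input I) x <= X%:R ->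
  ok (word D X)
    (6 + (n.+1 * (2 + n.+1 * 20 + (10 + (2 + ((4 * n).+1 * (2 * n).+1) * 51 + 13))).+1))
    scheduler (initial_state I) (fun m => algorithm1 I (output m)).
Proof.
move=> D_gt0 X_ge D_int X_le.
have input_int j : [/\ first_time I j * D%:R \is a Num.int,
    delay I j * D%:R \is a Num.int & second_time I j * D%:R \is a Num.int].
  by have [? ? ?] := mem_input j; split; apply: D_int.
have input_le : \sum_j (first_time I j + delay I j + second_time I j) <= X%:R.
  by rewrite -sum_input.
pose Inv k m := exists js, k = (n - size js)%N /\ scheduler_invariant I D js m.
have step k m : Inv k m ->
    [/\ (bitsize (reg m rEnd) <= word D X)%N, (bitsize (reg m rLimit) <= word D X)%N
       & reg m rEnd < reg m rLimit ->
         ok (word D X) (2 + n.+1 * 20 + (10 + (2 + ((4 * n).+1 * (2 * n).+1) * 51 + 13)))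
           round m (fun m' => exists2 k', (k' < k)%N & Inv k' m')].
  move=> [js [-> inv]]; have [_ [eB eLim eE] ujs _ _ _ _ _ _ _ _] := inv.
  have js_n : (size js <= n)%N.
    by rewrite -[leqRHS]card_ord -(card_uniqP ujs) max_card.
  have sE : sized D X 1 (reg m rEnd).
    by rewrite eE; apply: sized_nat; clear -js_n X_ge; lia.
  have sL : sized D X 1 (reg m rLimit).
    by rewrite eLim; apply: sized_nat; clear -X_ge; lia.
  split; try bounded.
  rewrite eE eLim ltr_nat => lt; have {}lt : (size js < n)%N by clear -lt; lia.
  apply: ok_weaken (round_ok D_gt0 X_ge input_int input_le inv lt) (leqnn _) _.
  move=> m' [j jjs inv']; exists (n - (size js).+1)%N.
    by rewrite subnS ltn_predL subn_gt0.
  by exists (rcons js j); rewrite size_rcons.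
apply: ok_seq.
set m0 := initial_state I.
have sn : sized D X 1 (reg m0 rN) by apply: sized_nat; clear -X_ge; lia.
have s0 : sized D X 1 (reg m0 rZero) by apply: (@sized_nat D X 0).
apply: (@wp_ok _ prepare); rewrite /prepare.
rewrite ?wpE; split; first by rewrite /word addn_gt0.
rewrite /= ?updE /=; symex; symex; symex; symex; symex.
set m1 := State _ _.
have inv1 : scheduler_invariant I D [::] m1.
  split=> //.
  - by split=> //; rewrite /m1 /= ?updE //=; ring.
  - by split=> //; rewrite /m1 /= ?updE //=; ring.
  - by move=> j; rewrite /m1 /= -[(3 * j)%N]addn0 nth_input.
  - by move=> j; rewrite /m1 /= -addn1 nth_input.
  - by move=> j; rewrite /m1 /= -addn2 nth_input.
  - by case.
have start : Inv n m1 by exists [::]; rewrite subn0.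
apply: ok_weaken (ok_while step start) (leqnn _) _ => m [[k [js [_ inv]]]].
have [_ [eB eLim eE] ujs _ _ _ _ _ srt _ gr] := inv.
rewrite eE eLim ler_nat => le.
apply: (algorithm1_seq ujs _ srt gr).
(* On exit the table is full, so the duplicate-free list has at least [n] entries, hence exactly
   [n]. *)
apply/eqP; rewrite eqn_leq -{1}[n in (_ <= n)%N]card_ord -{1}(card_uniqP ujs) max_card.
by clear -le; lia.
Qed.

End InitialState.

(** * Bounds in terms of the input size *)

Lemma ltn_bits k : (k < 2 ^ bits k)%N.
Proof. by rewrite /bits; apply: trunc_log_ltn. Qed.

Lemma bits_le k l : (k <= 2 ^ l)%N -> (bits k <= l.+1)%N.
Proof. by move=> kl; rewrite ltnS -(@trunc_expnK 2 l) // leq_trunc_log. Qed.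

Lemma expn2_gt0 k : (0 < 2 ^ k)%N.
Proof. by rewrite expn_gt0. Qed.

Lemma prod_den_le (s : seq rat) :
  (\prod_(x <- s) `|denq x| <= 2 ^ (\sum_(x <- s) bitsize x))%N.
Proof.
elim: s => [|x s IH]; first by rewrite !big_nil.
rewrite !big_cons expnD leq_mul //.
apply: leq_trans (ltnW (ltn_bits _)) _.
by rewrite leq_exp2l // leq_addl.
Qed.

(** A sum of numbers below powers of 2 is at most the product of these powers, whose exponents add
    up to the total bit size. *)
Lemma sum_num_le (s : seq rat) :
  (\sum_(x <- s) `|numq x| <= 2 ^ (\sum_(x <- s) bitsize x))%N.
Proof.
elim: s => [|x s IH]; first by rewrite !big_nil.
rewrite !big_cons expnD.
have : (`|numq x| < 2 ^ bitsize x)%N.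
  apply: leq_trans (ltn_bits _) _.
  by rewrite leq_exp2l // /bitsize -addnA addnCA leq_addr.
have := expn2_gt0 (\sum_(x <- s) bitsize x).
move: IH; move: (\sum_(x <- s) _)%N (2 ^ _)%N (2 ^ _)%N => u v w.
by nia.
Qed.

Lemma denq_int (s : seq rat) x : x \in s ->
  x * (\prod_(y <- s) `|denq y|)%N%:R \is a Num.int.
Proof.
move=> xs; rewrite (big_rem x xs) /= natrM mulrA.
have -> : x * (absz (denq x))%:R = (numq x)%:~R.
  by rewrite numqE natr_absz normr_denq.
by rewrite rpredM ?rpred_nat // intr_int.
Qed.

Lemma sum_le_num (s : seq rat) :
  \sum_(x <- s) x <= (\sum_(x <- s) `|numq x|)%N%:R.
Proof.
rewrite natr_sum; apply: ler_sum => x _.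
rewrite natr_absz intr_norm numqE normrM.
apply: le_trans (ler_norm x) _; rewrite ler_peMr //.
by rewrite -intr_norm normr_denq ler1z -gtz0_ge1 denq_gt0.
Qed.

Lemma horner_cost (k l N : nat) :
  (('X + 1) * ('X + 1) * ('X + 1) * k%:P * (('X + 1) * l%:P)).[N] =
  ((N + 1) ^ 3 * k * ((N + 1) * l))%N.
Proof.
rewrite !hornerM !hornerD hornerX !hornerC.
by have -> : ((N + 1) ^ 3 = (N + 1) * (N + 1) * (N + 1))%N by rewrite !expnS expn0 muln1 mulnA.
Qed.

(** The first factor counts instructions and is cubic in [n]: rounds times the quadratic scan. The
    second is the cost of one instruction, linear in the word length. *)
Lemma cost_bound n N w : (n <= N)%N -> (w <= 3 * N + 13)%N ->
  ((6 + (n.+1 * (2 + n.+1 * 20 +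
      (10 + (2 + ((4 * n).+1 * (2 * n).+1) * 51 + 13))).+1)) * (2 * w).+1 <=
   (N + 1) ^ 3 * 520 * ((N + 1) * 40))%N.
Proof.
move=> nN wN; apply: leq_mul; last by lia.
have nM : (n.+1 <= N + 1)%N by lia.
have [e2 e1] : (((N + 1) ^ 2 <= (N + 1) ^ 3) /\ (1 <= (N + 1) ^ 2))%N.
  by rewrite addn1 leq_pexp2l // expn_gt0.
have n2 : (n.+1 * n.+1 <= (N + 1) ^ 2)%N by rewrite leq_mul.
have n3 : (n.+1 * (n.+1 * n.+1) <= (N + 1) ^ 3)%N by rewrite !leq_mul.
nia.
Qed.

Lemma scheduler_polynomial : computes_algorithm1_in_polynomial_time scheduler.
Proof.
exists (('X + 1) * ('X + 1) * ('X + 1) * 520%N%:P * (('X + 1) * 40%N%:P)) => n I.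
pose N := input_size I; pose D := (\prod_(x <- input I) `|denq x|)%N.
(* The part [8 * n + 3] covers the addresses, and the sum of the numerators bounds the sum of the
   input. *)
pose X := (8 * n + 3 + \sum_(x <- input I) `|numq x|)%N.
have D_gt0 : (0 < D)%N by rewrite prodn_gt0 // => x; rewrite absz_gt0 denq_neq0.
have sN : (\sum_(x <- input I) bitsize x <= N)%N by apply: leq_addl.
have nN : (n <= N)%N.
  apply: leq_trans sN; apply: (@leq_trans (size (input I))).
    rewrite /input size_flatten /shape -map_comp sumnE big_map big_enum /=.
    by rewrite sum_nat_const card_ord; clear; lia.
  by rewrite -sum1_size; apply: leq_sum.
have DN : (D <= 2 ^ N)%N.
  by apply: leq_trans (prod_den_le _) _; rewrite leq_exp2l.
have XN : (X <= 2 ^ (N + 4))%N.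
  have numN : (\sum_(x <- input I) `|numq x| <= 2 ^ N)%N.
    by apply: leq_trans (sum_num_le _) _; rewrite leq_exp2l.
  have := leq_ltn_trans nN (ltn_expl N (isT : 1 < 2)%N).
  rewrite expnD /X; move: numN; move: (\sum_(x <- _) _)%N (2 ^ N)%N => u v; clear.
  by rewrite -[(2 ^ 4)%N]/16%N; lia.
have word_le : (word D X <= 3 * N + 13)%N.
  rewrite /word; have := bits_le DN.
  have : (64 * X * D <= 2 ^ (2 * N + 10))%N.
    have -> : (2 * N + 10 = 6 + (N + 4) + N)%N by clear; lia.
    by rewrite (expnD 2 (6 + _)) (expnD 2 6); apply: leq_mul => //; apply: leq_mul.
  by move=> /bits_le; clear; lia.
have X_le : \sum_(x <- input I) x <= X%:R.
  by apply: le_trans (sum_le_num _) _; rewrite ler_nat leq_addl.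
have X_gt : (8 * n + 2 < X)%N by rewrite /X; clear; lia.
have [c [m [r c_le alg]]] := scheduler_ok D_gt0
  X_gt (@denq_int _) X_le.
exists c, m; split=> //; rewrite horner_cost.
exact: leq_trans c_le (cost_bound nN word_le).
Qed.

Theorem theorem9 :
  (exists P : program, computes_algorithm1_in_polynomial_time P) /\
  (forall (R : realFieldType) (n : nat) (I : instance R n) (p : 'I_n -> R),
     (forall j : 'I_n,
        [/\ first_time I j = p j, delay I j = p j & second_time I j = p j]) ->
     (exists S : 'I_n -> R, algorithm1 I S) /\
     (forall S : 'I_n -> R, algorithm1 I S ->
        feasible I S /\
        (forall S' : 'I_n -> R, feasible I S' ->
           total_completion I S <= 3%:R / 2%:R * total_completion I S'))).
Proof.
split; first by exists scheduler; exact: scheduler_polynomial.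
move=> R n I p Ip; split; first exact: exists_algorithm1.
move=> S alg; split; first exact: algorithm1_feasible.
by move=> S'; apply: (algorithm1_total_le Ip).
Qed.
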